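(* Let $\mathcal{M}$ be a family of nonzero finitely generated abelian groups and put $M=\prod\mathcal{M}$ and $S=\bigoplus\mathcal{M}$. Then the following conditions are equivalent: (1) $M$ is self-small; (2) either $T_S=0$, or $S_{(p)}$ is finite for each $p\in\mathbb{P}$ and $S/T_S$ is finitely generated; (3) either all $A\in\mathcal{M}$ are free, or the family $\{B\in\mathcal{M}\mid \mathrm{Hom}(B,A)\neq 0\}$ is finite for each $A\in\mathcal{M}$; (4) either $M\cong\mathbb{Z}^\kappa$ (direct product of $\kappa$ copies of $\mathbb{Z}$) for some cardinal $\kappa$, or $M\cong F\oplus\prod_{p\in\mathbb{P}}M_p$ for some finitely generated free abelian group $F$ and some finite abelian $p$-groups $M_p$, one for each $p\in\mathbb{P}$.
   Context: All groups are abelian. $\mathbb{P}$ is the set of all prime numbers. A family of groups may contain more than one copy of a group (i.e. it is an indexed family), and finiteness of subfamilies is counted with multiplicity (by index). For an abelian group $A$, $T_A=\bigoplus_{p\in\mathbb{P}}A_{(p)}$ denotes the torsion part of $A$, where $A_{(p)}$ is the $p$-component of the torsion part. An abelian group $A$ is self-small if for every set $I$ the canonical injective homomorphism $\bigoplus_{i\in I}\mathrm{Hom}(A,A)\to\mathrm{Hom}(A,A^{(I)})$, $(f_i)_i\mapsto\sum_i f_i$, is an isomorphism, where $A^{(I)}$ is the direct sum of $I$ copies of $A$. ''Either ... or'' is inclusive. *)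

(* Defs.v *)
From HB Require Import structures.
From mathcomp Require Import all_boot all_order all_algebra.
From mathcomp Require Import boolp classical_sets functions cardinality.

Set Implicit Arguments.
Unset Strict Implicit.
Unset Printing Implicit Defensive.

Import GRing.Theory.

Local Open Scope classical_set_scope.
Local Open Scope ring_scope.

(* Abelian groups are zmodTypes. A family of groups is a function out of an
   arbitrary index type, so repetitions are allowed and are counted by index. *)

Definition dprodType (I : Type) (A : I -> zmodType) : Type := forall i, A i.

Section DirectProduct.
Variables (I : Type) (A : I -> zmodType).

HB.instance Definition _ := gen_eqMixin (dprodType A).
HB.instance Definition _ := gen_choiceMixin (dprodType A).

Definition dprod_zero : dprodType A := fun=> 0.
Definition dprod_opp (f : dprodType A) : dprodType A := fun i => - f i.
Definition dprod_add (f g : dprodType A) : dprodType A := fun i => f i + g i.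

Fact dprod_addA : associative dprod_add.
Proof. by move=> f g h; apply: functional_extensionality_dep => i; exact: addrA. Qed.

Fact dprod_addC : commutative dprod_add.
Proof. by move=> f g; apply: functional_extensionality_dep => i; exact: addrC. Qed.

Fact dprod_add0 : left_id dprod_zero dprod_add.
Proof. by move=> f; apply: functional_extensionality_dep => i; exact: add0r. Qed.

Fact dprod_addN : left_inverse dprod_zero dprod_opp dprod_add.
Proof. by move=> f; apply: functional_extensionality_dep => i; exact: addNr. Qed.

HB.instance Definition _ := GRing.isZmodule.Build (dprodType A)
  dprod_addA dprod_addC dprod_add0 dprod_addN.

Definition finsupp : {pred dprodType A} :=
  fun f => `[< finite_set [set i | f i != 0] >].

Fact finsupp_zmod_closed : zmod_closed finsupp.
Proof.
split=> [|f g /asboolP ff /asboolP fg]; apply/asboolP.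
  by apply: (sub_finite_set _ (finite_set0 I)) => i /=; rewrite eqxx.
apply: (@sub_finite_set _ _ ([set i | f i != 0] `|` [set i | g i != 0])).
  move=> i /= fgi; case: (eqVneq (f i) 0) => [fi|]; last by left.
  right; apply: contra_neq fgi => gi.
  by rewrite -[LHS]/(f i - g i) fi gi subrr.
by rewrite finite_setU.
Qed.

HB.instance Definition _ := GRing.isZmodClosed.Build (dprodType A) finsupp
  finsupp_zmod_closed.

Record dsumType : Type :=
  DSum { dsum_val :> dprodType A; _ : dsum_val \in finsupp }.

HB.instance Definition _ := [isSub for dsum_val].
HB.instance Definition _ := [Choice of dsumType by <:].
HB.instance Definition _ := [SubChoice_isSubZmodule of dsumType by <:].

End DirectProduct.

Definition homType (A B : zmodType) : Type := {additive A -> B}.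

Section Hom.
Variables A B : zmodType.

Definition hom_fun (f : homType A B) : {additive A -> B} := f.
Coercion hom_fun : homType >-> GRing.Additive.type.

HB.instance Definition _ := gen_eqMixin (homType A B).
HB.instance Definition _ := gen_choiceMixin (homType A B).

Lemma homP (f g : homType A B) : (forall x, f x = g x) -> f = g.
Proof.
case: f g => [f [[cf]]] [g [[cg]]] /= /funext fg.
by case: _ / fg in cg *; rewrite (Prop_irrelevance cf cg).
Qed.

Definition hom_zero : homType A B := (\0 : A -> B) : {additive A -> B}.
Definition hom_opp (f : homType A B) : homType A B :=
  (\- (f : {additive A -> B})) : {additive A -> B}.
Definition hom_add (f g : homType A B) : homType A B :=
  ((f : {additive A -> B}) \+ (g : {additive A -> B})) : {additive A -> B}.

Fact hom_addA : associative hom_add.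
Proof. by move=> f g h; apply: homP => x; exact: addrA. Qed.

Fact hom_addC : commutative hom_add.
Proof. by move=> f g; apply: homP => x; exact: addrC. Qed.

Fact hom_add0 : left_id hom_zero hom_add.
Proof. by move=> f; apply: homP => x; exact: add0r. Qed.

Fact hom_addN : left_inverse hom_zero hom_opp hom_add.
Proof. by move=> f; apply: homP => x; exact: addNr. Qed.

HB.instance Definition _ := GRing.isZmodule.Build (homType A B)
  hom_addA hom_addC hom_add0 hom_addN.

End Hom.

Section SelfSmall.
Variables (A : zmodType) (I : Type).

Fact dsum_hom_finsupp (f : dsumType (fun _ : I => homType A A)) (a : A) :
  ((fun i => (f : dprodType _) i a) : dprodType (fun _ : I => A))
    \in @finsupp I (fun=> A).
Proof.
case: f => f /= /asboolP ff; apply/asboolP; apply: sub_finite_set ff => i /=.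
by apply: contra_neq => ->.
Qed.

Definition dsum_hom_fun (f : dsumType (fun _ : I => homType A A)) (a : A) :
  dsumType (fun _ : I => A) := DSum (dsum_hom_finsupp f a).

Fact dsum_hom_fun_zmod_morphism f : zmod_morphism (dsum_hom_fun f).
Proof.
move=> a b; apply/val_inj; apply: functional_extensionality_dep => i /=.
exact: raddfB.
Qed.

HB.instance Definition _ f := GRing.isZmodMorphism.Build A
  (dsumType (fun _ : I => A)) (dsum_hom_fun f) (dsum_hom_fun_zmod_morphism f).

(* The canonical homomorphism (f_i)_i |-> \sum_i f_i: f_i is read as a map into
   the i-th copy of A, so that the sum sends a to the element (f_i a)_i. *)
Definition dsum_hom (f : dsumType (fun _ : I => homType A A)) :
  homType A (dsumType (fun _ : I => A)) :=
  dsum_hom_fun f : {additive A -> dsumType (fun _ : I => A)}.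

Fact dsum_hom_zmod_morphism : zmod_morphism dsum_hom.
Proof.
move=> f g; apply: homP => a; apply/val_inj.
by apply: functional_extensionality_dep.
Qed.

HB.instance Definition _ := GRing.isZmodMorphism.Build
  (dsumType (fun _ : I => homType A A)) (homType A (dsumType (fun _ : I => A)))
  dsum_hom dsum_hom_zmod_morphism.

End SelfSmall.

Definition self_small (A : zmodType) : Prop :=
  forall I : Type, bijective (@dsum_hom A I).

Definition isomorphic (A B : zmodType) : Prop :=
  exists f : {additive A -> B}, bijective f.

Definition finitely_generated (A : zmodType) : Prop :=
  exists (n : nat) (g : 'I_n -> A),
    forall x : A, exists c : 'I_n -> int, x = \sum_(i < n) g i *~ c i.

Definition free_group (A : zmodType) : Prop :=
  exists B : Type, isomorphic A (dsumType (fun _ : B => int : zmodType)).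

Section Torsion.
Variable A : zmodType.

Definition torsion : {pred A} :=
  fun x => `[< exists2 n : nat, (0 < n)%N & x *+ n = 0 >].

Fact torsion_zmod_closed : zmod_closed torsion.
Proof.
split=> [|x y /asboolP[m m0 xm] /asboolP[n n0 yn]]; apply/asboolP.
  by exists 1%N.
exists (m * n)%N; first by rewrite muln_gt0 m0.
by rewrite mulrnBl mulrnA xm mulnC mulrnA yn !mul0rn subrr.
Qed.

HB.instance Definition _ := GRing.isZmodClosed.Build A torsion
  torsion_zmod_closed.

Definition pcomponent (p : nat) : set A :=
  [set x | x \in torsion /\ exists k : nat, x *+ (p ^ k)%N = 0].

End Torsion.
Arguments torsion : clear implicits.
Arguments pcomponent : clear implicits.

Definition primes_type : Type := {p : nat | prime p}.

(* Main.v *)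
Require Import Defs.
From HB Require Import structures.
From mathcomp Require Import all_boot all_order all_algebra fingroup pgroup.
From mathcomp Require Import cyclic zify ring.
From mathcomp Require Import boolp classical_sets functions cardinality.

(** Write M for the product and S for the direct sum of the family.  M is
    self-small exactly when a sequence of endomorphisms of M that vanishes
    eventually at each element has a zero term ([self_smallP]).

    (1) implies (2).  If a prime p divides the order of some element of M and
    infinitely many members satisfy A <> pA, choosing elements outside pA in
    them gives a sequence of M that is independent modulo p.  It extends to a
    basis modulo p, whose coordinates, multiplied by an element of order p, form
    a sequence of nonzero endomorphisms forbidden above ([dual_sequence]).  So
    almost all members satisfy A = pA; being finitely generated, such a member
    is killed by an integer prime to p ([fg_divisible]), hence contributes
    neither to the p-component of S nor to S modulo torsion.

    (2) implies (3).  Torsion-free finitely generated groups are free.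
    Otherwise, representatives of generators of S modulo torsion have finite
    support, so almost all members are torsion groups.  A nonzero homomorphism
    from a torsion member to A meets one of the finitely many primes in the
    exponent of the torsion of A ([torsion_hom_prime]), and each prime occurs in
    finitely many members.

    (3) implies (4).  Every member is a product of cyclic groups of infinite or
    prime power order ([fg_cyclic], by an argument of Rado), so M is one large
    product of such groups.  In the second case of (3) each prime, and likewise
    the infinite order, labels finitely many factors; grouping the factors by
    label gives the decomposition ([finite_hom_product]).

    (4) implies (1).  For a power of the integers, the group of finitely
    supported sequences of integers is slender ([slender]).  Applied to disjoint
    sets of coordinates, this confines a bad sequence of maps to a set E of
    coordinates that is an atom: of any two complementary parts of E the maps
    ignore one.  Then they only see the constant vector on E
    ([atom_constant]), at which almost all of them vanish
    ([integer_power_finite]).  In the mixed case the finitely generated summand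
    is harmless and a homomorphism of the product of the p-groups acts
    componentwise because the other components are p-divisible
    ([product_hom_component]); one element meeting the last nonzero map on each
    component finishes the proof ([self_small_mixed]). *)

Set Implicit Arguments.
Unset Strict Implicit.
Unset Printing Implicit Defensive.

Import GRing.Theory.

Local Open Scope classical_set_scope.
Local Open Scope ring_scope.

(** * Finitely generated groups: independent generators of primary order *)

Section Span.
Variable A : zmodType.
Implicit Types (s t : seq A) (g h x y : A) (c d : int).

Fixpoint span s x : Prop :=
  if s is g :: s' then exists c, span s' (x - g *~ c) else x = 0.

Lemma span0 s : span s 0.
Proof. by elim: s => //= g s IH; exists 0; rewrite mulr0z subr0. Qed.

Lemma spanB s x y : span s x -> span s y -> span s (x - y).
Proof.
elim: s x y => [x y -> ->|g s IH x y [c hc] [d hd]] /=; first by rewrite subrr.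
by exists (c - d); rewrite mulrzBr opprD addrACA -opprD; apply: IH.
Qed.

Lemma spanN s x : span s x -> span s (- x).
Proof. by move=> sx; rewrite -[- x]add0r; apply: spanB => //; apply: span0. Qed.

Lemma spanD s x y : span s x -> span s y -> span s (x + y).
Proof. by move=> sx sy; rewrite -[y]opprK; apply/spanB/spanN. Qed.

Lemma spanMz s x c : span s x -> span s (x *~ c).
Proof.
move=> sx; have nat_case n : span s (x *+ n).
  by elim: n => [|n IH]; [apply: span0|rewrite mulrS; apply: spanD].
by case: c => n; [apply: nat_case|apply/spanN/nat_case].
Qed.

Lemma span_cons s g x : span s x -> span (g :: s) x.
Proof. by move=> sx; exists 0; rewrite mulr0z subr0. Qed.

Lemma span_head s g : span (g :: s) g.
Proof. by exists 1; rewrite mulr1z subrr; apply: span0. Qed.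

Lemma span_mem s g : g \in s -> span s g.
Proof.
elim: s => //= h s IH; rewrite inE => /predU1P[->|/IH]; first exact: span_head.
exact: span_cons.
Qed.

Lemma span_sub s t x : (forall g, g \in s -> span t g) -> span s x -> span t x.
Proof.
elim: s x => [x _ ->|g s IH x st [c /IH sx]]; first exact: span0.
rewrite -[x](subrK (g *~ c)); apply: spanD; last first.
  by apply/spanMz/st/mem_head.
by apply: sx => h hs; apply: st; rewrite inE hs orbT.
Qed.

Lemma eq_span_cons s t g :
  (forall x, span s x <-> span t x) ->
  forall x, span (g :: s) x <-> span (g :: t) x.
Proof. by move=> st x; split=> -[c /st]; exists c. Qed.

(** Bezout for [c] and [d], with a choice of cofactors that still works when
    both numbers are zero. *)
Lemma bezout_cofactors c d :
  exists e a b u v, [/\ c = a * e, d = b * e & u * a + v * b = 1].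
Proof.
have [g0|g0] := eqVneq (gcdz c d) 0.
  move/eqP: g0; rewrite gcdz_eq0 => /andP[/eqP-> /eqP->].
  by exists 0, 1, 0, 1, 0; rewrite !mulr0 mulr1 addr0.
have [u [v uv]] := Bezoutz c d.
exists (gcdz c d), (c %/ gcdz c d)%Z, (d %/ gcdz c d)%Z, u, v.
have ec := divzK (dvdz_gcdl c d); have ed := divzK (dvdz_gcdr c d).
split=> //; apply: (mulIf g0); rewrite mul1r mulrDl -!mulrA ec ed; exact: uv.
Qed.

(** Unimodular changes of generators concentrate a relation on a single
    generator: this is the Euclidean algorithm on its coefficients. *)
Lemma span_collapse s g c y : span s y ->
  exists d h s', [/\ size s' = size s, (d %| c)%Z, g *~ c + y = h *~ d &
    forall x, span (h :: s') x <-> span (g :: s) x].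
Proof.
elim: s g c y => [|g1 s IH] g c y.
  by move=> /= ->; exists c, g, [::]; rewrite addr0.
case=> c1 /(IH g1 c1)[d1 [h1 [t [szt dc1 eq1 sp1]]]].
have {}eq1 : y = h1 *~ d1 by rewrite -eq1 addrC subrK.
have [d [a [b [u [v [ec ed uv]]]]]] := bezout_cofactors c d1.
pose h := g *~ a + h1 *~ b; pose h' := g *~ (- v) + h1 *~ u.
exists d, h, (h' :: t); split.
- by rewrite /= szt.
- by rewrite ec dvdz_mull.
- by rewrite eq1 ec ed !mulrzA -mulrzDl.
move=> x; apply: (iff_trans _ (eq_span_cons g sp1 x)).
have linZ m n k : (g *~ m + h1 *~ n) *~ k = g *~ (m * k) + h1 *~ (n * k).
  by rewrite mulrzDl !mulrzA.
have linD m n m' n' : (g *~ m + h1 *~ n) + (g *~ m' + h1 *~ n') =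
    g *~ (m + m') + h1 *~ (n + n') by rewrite addrACA -!mulrzDr.
have eg : g = h *~ u + h' *~ (- b).
  rewrite !linZ linD; have -> : a * u + - v * - b = 1 by rewrite -uv; ring.
  have -> : b * u + u * - b = 0 by ring.
  by rewrite mulr1z mulr0z addr0.
have eh1 : h1 = h *~ v + h' *~ a.
  rewrite !linZ linD; have -> : a * v + - v * a = 0 by ring.
  have -> : b * v + u * a = 1 by rewrite -uv; ring.
  by rewrite mulr1z mulr0z add0r.
split; apply: span_sub => z; rewrite !inE => /or3P[/eqP->|/eqP->|zt].
- apply: spanD; apply: spanMz; first exact: span_head.
  exact/span_cons/span_head.
- apply: spanD; apply: spanMz; first exact: span_head.
  exact/span_cons/span_head.
- by do 2!apply: span_cons; apply: span_mem.
- rewrite eg; apply: spanD; apply: spanMz; first exact: span_head.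
  exact/span_cons/span_head.
- rewrite eh1; apply: spanD; apply: spanMz; first exact: span_head.
  exact/span_cons/span_head.
- by do 2!apply: span_cons; apply: span_mem.
Qed.

(** The pairs are generators with their orders, and order 0 means infinite;
    independence is read off from the head, as in [span]. *)
Fixpoint indep (s : seq (A * nat)) : Prop :=
  if s is (g, q) :: s' then
    [/\ forall c, span (unzip1 s') (g *~ c) -> (q %| c)%Z, g *+ q = 0 &
        indep s']
  else True.

(** Orders of the indecomposable cyclic groups, 0 again meaning infinite. *)
Definition primary (q : nat) :=
  q = 0%N \/ exists p e, prime p /\ q = (p ^ e.+1)%N.

(** Rado's argument: among all generating lists of the given length, take one
    whose head has least order.  A relation in which the head has a smaller
    nonzero coefficient would collapse to a generator of smaller order; any
    nonzero coefficient counts as smaller if no head has finite order. *)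
Lemma rado s :
  exists t : seq (A * nat), indep t /\ forall x, span (unzip1 t) x <-> span s x.
Proof.
have [n] := ubnP (size s); elim: n s => // n IHn [_|g0 s0 sz].
  by exists [::].
pose good k := `[< exists g t, [/\ size t = size s0, (0 < k)%N, g *+ k = 0 &
  forall x, span (g :: t) x <-> span (g0 :: s0) x] >].
have split_head g t (q : nat) : size t = size s0 ->
    (forall x, span (g :: t) x <-> span (g0 :: s0) x) ->
    (forall c, span t (g *~ c) -> (q %| c)%Z) -> g *+ q = 0 ->
  exists t' : seq (A * nat),
    indep t' /\ forall x, span (unzip1 t') x <-> span (g0 :: s0) x.
  move=> szt spt div ord; have [|t' [it' st']] := IHn t; first by rewrite szt.
  exists ((g, q) :: t'); split=> [|x] /=; first by split=> // c /st' /div.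
  exact: iff_trans (eq_span_cons g st' x) (spt x).
have collapse g t c : size t = size s0 ->
    (forall x, span (g :: t) x <-> span (g0 :: s0) x) ->
    span t (g *~ c) -> c != 0 ->
  exists2 d : int, (d %| c)%Z & good `|d|%N.
  move=> szt spt /spanN /(span_collapse g c)[d [h [t' [szt' dc]]]].
  rewrite subrr => hd spt' c0; exists d => //; apply/asboolP; exists h, t'.
  split; first by rewrite szt'.
  - rewrite absz_gt0; apply: contraNneq c0 => d0.
    by move: dc; rewrite d0 dvd0z.
  - case: {dc} d hd => m /esym //=; rewrite NegzE mulrNz => /eqP.
    by rewrite oppr_eq0 => /eqP.
  - by move=> x; apply: iff_trans (spt x).
have [gk|nogood] := pselect (exists k, good k).
  case: (ex_minnP gk) => k /asboolP[g [t [szt k0 gk0 spt]]] mink.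
  apply: (split_head g t k) => // c sgc.
  have gkz : g *~ k%:Z = 0 by [].
  have sgr : span t (g *~ (c %% k)%Z).
    have -> : (c %% k)%Z = c - (c %/ k)%Z * k.
      by rewrite {2}(divz_eq c k) addrC addKr.
    by rewrite mulrzBr [_ * k%:Z]mulrC mulrzA gkz mul0rz subr0.
  apply: contraT => ndiv; have r0 : (c %% k)%Z != 0.
    by apply: contra ndiv => /eqP r0; apply/dvdz_mod0P.
  have [d dr /mink kd] := collapse _ _ _ szt spt sgr r0.
  have kz : k%:Z != 0 by rewrite eqz_nat -lt0n.
  have := modz_ge0 c kz; have := ltz_mod c kz => /=.
  move: dr; rewrite dvdzE => /dvdn_leq.
  rewrite absz_gt0 r0 => /(_ isT); move: (c %% k)%Z => r; lia.
apply: (split_head g0 s0 0%N) => // c sgc.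
rewrite dvd0z; apply: contraT => c0; case: nogood.
by have [d _ gd] := collapse g0 s0 c erefl (fun=> iff_refl _) sgc c0; exists `|d|%N.
Qed.

(** A generator of finite order splits along the Chinese remainder theorem. *)
Lemma primary_split (d : nat) g (s : seq (A * nat)) : (0 < d)%N -> g *+ d = 0 ->
    (forall c, span (unzip1 s) (g *~ c) -> (d %| c)%Z) ->
    indep s -> {in s, forall z, primary z.2} ->
  exists t : seq (A * nat), [/\ indep t, {in t, forall z, primary z.2} &
    forall x, span (unzip1 t) x <-> span (g :: unzip1 s) x].
Proof.
have [n] := ubnP d; elim: n d g s => // n IHn d g s dn d0 gd0 div si ps.
have [d1|d1] := eqVneq d 1%N.
  exists s; split=> // x; split=> [|[c]]; first exact: span_cons.
  by move: gd0; rewrite d1 mulr1n => ->; rewrite mul0rz subr0.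
have d_gt1 : (1 < d)%N by rewrite ltn_neqAle eq_sym d1.
(* The part of [g] of order [a], a power of [p], is split off; the rest has
   the smaller order [b]. *)
pose p := pdiv d; have pp : prime p by apply: pdiv_prime.
pose a := (d`_p)%N; pose b := (d`_p^')%N.
have dab : d = (a * b)%N by rewrite partnC.
have [e ae] : exists e, a = (p ^ e.+1)%N.
  exists (logn p d).-1; rewrite /a p_part prednK // logn_gt0 mem_primes pp d0.
  exact: pdiv_dvd.
have ab : coprime a b by apply: coprime_partC.
have b0 : (0 < b)%N by apply: part_gt0.
have a1 : (1 < a)%N by rewrite ae -(exp1n e.+1) ltn_exp2r // prime_gt1.
have [||||t [it pt st]] := IHn b (g *+ a) s _ _ _ _ si ps.
- rewrite -ltnS; apply: leq_trans dn; rewrite dab ltnS; nia.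
- by [].
- by rewrite -mulrnA -dab.
- move=> c; have -> : g *+ a *~ c = g *~ (a%:Z * c) by rewrite mulrzA.
  by move/div; rewrite dab PoszM dvdz_mul2l ?eqz_nat -?lt0n ?(ltnW a1).
(* [g] is recovered from its multiples by [a] and [b] through Bezout. *)
have key u v : g = g *+ a *~ u + g *+ b *~ v ->
    exists t : seq (A * nat), [/\ indep t, {in t, forall z, primary z.2} &
    forall x, span (unzip1 t) x <-> span (g :: unzip1 s) x].
  move=> eg; exists ((g *+ b, a) :: t); split.
  - split=> //; last by rewrite -mulrnA mulnC -dab.
    move=> c /st [c']; have -> : g *+ b *~ c - g *+ a *~ c' =
      g *~ (b%:Z * c - a%:Z * c') by rewrite mulrzBr !mulrzA.
    move/div => dd; have : (a%:Z %| b%:Z * c)%Z.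
      rewrite -[b%:Z * c](subrK (a%:Z * c')) rpredD ?dvdz_mulr //.
      by apply: dvdz_trans dd; rewrite dab PoszM dvdz_mulr.
    by rewrite Gauss_dvdzr.
  - move=> z; rewrite inE => /predU1P[-> /=|/pt //]; right.
    by exists p, e.
  - move=> x; apply: (iff_trans (eq_span_cons _ st x)).
    split; apply: span_sub => z; rewrite !inE.
      case/or3P=> [/eqP->|/eqP->|zt].
      + exact: (@spanMz _ _ b%:Z (span_head _ _)).
      + exact: (@spanMz _ _ a%:Z (span_head _ _)).
      + exact/span_cons/span_mem.
    case/orP=> [/eqP->|zt]; last by do 2!apply: span_cons; apply: span_mem.
    rewrite {3}eg; apply: spanD; apply: spanMz; last exact: span_head.
    exact/span_cons/span_head.
have [u [v uv]] := Bezoutz a b.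
have gab : gcdz a b = 1 by apply/eqP; exact: ab.
apply: (key u v).
have -> : g *+ a *~ u + g *+ b *~ v = g *~ (a%:Z * u + b%:Z * v).
  by rewrite mulrzDr !mulrzA.
by rewrite mulrC [b%:Z * v]mulrC uv gab mulr1z.
Qed.

Lemma fg_primary_basis : finitely_generated A ->
  exists s : seq (A * nat), [/\ indep s, {in s, forall z, primary z.2} &
    forall x, span (unzip1 s) x].
Proof.
case=> n [g gen]; pose s0 := [seq g i | i <- enum 'I_n].
have span_s0 x : span s0 x.
  have [c ->] := gen x; apply: (big_ind (span s0)) => [||i _].
  - exact: span0.
  - by move=> y z; apply: spanD.
  - by apply/spanMz/span_mem/map_f; rewrite mem_enum.
have [t [it st]] := rado s0.
suff [s [si ps ss]] : exists s : seq (A * nat),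
    [/\ indep s, {in s, forall z, primary z.2} &
        forall x, span (unzip1 s) x <-> span (unzip1 t) x].
  by exists s; split=> // x; apply/ss/st.
elim: t it {st} => [|[h q] t IH] /=; first by exists [::].
case=> div hq /IH[s [si ps ss]].
have eq_hs := eq_span_cons h ss.
have {}div c : span (unzip1 s) (h *~ c) -> (q %| c)%Z by move/ss/div.
have [q0|q0] := posnP q.
  exists ((h, q) :: s); split=> // z; rewrite inE => /predU1P[->|/ps //].
  by left.
have [t' [it' pt' st']] := primary_split q0 hq div si ps.
by exists t'; split=> // x; apply: iff_trans (eq_hs x).
Qed.

End Span.

(** * Isomorphisms and the decomposition into cyclic groups *)

Definition additive_of (A B : zmodType) (f : A -> B) (fB : zmod_morphism f) :
    {additive A -> B} :=
  HB.pack f (GRing.isZmodMorphism.Build A B f fB).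

Lemma inj_surj_bij (T U : Type) (f : T -> U) :
  injective f -> (forall y, exists x, f x = y) -> bijective f.
Proof.
move=> f_inj /choice[g gK]; exists g => // x.
by apply: f_inj; rewrite gK.
Qed.

Lemma isomorphic_of (A B : zmodType) (f : A -> B) : zmod_morphism f ->
  (forall x, f x = 0 -> x = 0) -> (forall y, exists x, f x = y) ->
  isomorphic A B.
Proof.
move=> fB f0 f_surj; exists (additive_of fB); apply: inj_surj_bij => //.
by move=> x y /eqP; rewrite -subr_eq0 -[_ - _]fB => /eqP/f0/eqP;
  rewrite subr_eq0 => /eqP.
Qed.

Lemma isomorphic_refl A : isomorphic A A.
Proof. by apply: (@isomorphic_of _ _ id) => // y; exists y. Qed.

Lemma isomorphic_sym A B : isomorphic A B -> isomorphic B A.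
Proof.
case=> f [g fK gK]; apply: (@isomorphic_of _ _ g) => [x y|x gx|x].
- by rewrite -[in LHS](gK x) -[in LHS](gK y) -raddfB fK.
- by rewrite -[x]gK gx raddf0.
- by exists (f x).
Qed.

Lemma isomorphic_trans B A C :
  isomorphic A B -> isomorphic B C -> isomorphic A C.
Proof.
case=> f f_bij [g g_bij].
by exists (g \o f : {additive A -> C}); apply: bij_comp.
Qed.

Lemma isomorphic_prod A A' B B' : isomorphic A A' -> isomorphic B B' ->
  isomorphic (A * B)%type (A' * B')%type.
Proof.
case=> f [f' fK f'K] [g [g' gK g'K]].
apply: (@isomorphic_of _ _ (fun z : A * B => (f z.1, g z.2))).
- by move=> [x y] [x' y']; rewrite /= !raddfB.
- move=> [x y] [] /= fx gy; congr (_, _).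
    by rewrite -[x]fK fx -(raddf0 f) fK.
  by rewrite -[y]gK gy -(raddf0 g) gK.
- by move=> [x y]; exists (f' x, g' y); rewrite /= f'K g'K.
Qed.

Lemma isomorphic_dprod (I : Type) (A B : I -> zmodType) :
  (forall i, isomorphic (A i) (B i)) -> isomorphic (dprodType A) (dprodType B).
Proof.
move=> AB.
have ABg i : exists fg : {additive A i -> B i} * (B i -> A i),
    cancel fg.1 fg.2 /\ cancel fg.2 fg.1.
  by have [f [g fK gK]] := AB i; exists (f, g).
pose f i := (projT1 (cid (ABg i))).1; pose g i := (projT1 (cid (ABg i))).2.
have fK i : cancel (f i) (g i) by case: (projT2 (cid (ABg i))).
have gK i : cancel (g i) (f i) by case: (projT2 (cid (ABg i))).
apply: (@isomorphic_of _ _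
  (fun x : dprodType A => (fun i => f i (x i)) : dprodType B)).
- move=> x y; apply: functional_extensionality_dep => i; exact: raddfB.
- move=> x fx; apply: functional_extensionality_dep => i.
  have fxi : f i (x i) = 0 := congr1 (fun z : dprodType B => z i) fx.
  by rewrite -[LHS]fK fxi -(raddf0 (f i)) fK.
- move=> y; exists (fun i => g i (y i)).
  by apply: functional_extensionality_dep => i; rewrite gK.
Qed.

(** With the integers as the case [q = 0], a multiple of the generator vanishes
    if and only if [q] divides the coefficient, for every [q]. *)
Definition cyc (q : nat) : zmodType := if q is n.+1 then 'I_n.+1 else int.

Definition cgen (q : nat) : cyc q :=
  match q with 0 => 1 : int | n.+1 => inZp 1 end.

Lemma cgen_eq0 (q : nat) (c : int) : cgen q *~ c = 0 <-> (q %| c)%Z.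
Proof.
case: q => [|n] /=; first by rewrite intz dvd0z; split=> [->|/eqP].
have natP (m : nat) : (inZp 1 : 'I_n.+1) *+ m = 0 <-> (n.+1 %| m)%N.
  rewrite Zp_mulrn; split=> [/(congr1 val)|] /=.
    by rewrite modnMml mul1n => /eqP.
  by move=> nm; apply: val_inj; rewrite /= modnMml mul1n; apply/eqP.
case: c => m; rewrite dvdzE; first exact: natP.
rewrite NegzE mulrNz abszN; apply: iff_trans (natP _).
by rewrite -[_ *~ _]/(inZp 1 *+ m.+1); split=> [/eqP|->];
  rewrite ?oppr0 // oppr_eq0 => /eqP.
Qed.

Lemma cgen_onto (q : nat) (x : cyc q) : exists c, x = cgen q *~ c.
Proof.
case: q x => [|n] /= x; first by exists x; rewrite intz.
exists (x : nat); rewrite -pmulrn Zp_mulrn; apply: val_inj => /=.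
by rewrite modnMml mul1n modn_small.
Qed.

Lemma cyc_mulrn (q : nat) (x : cyc q) : x *+ q = 0.
Proof.
have [c ->] := cgen_onto x; rewrite pmulrn -mulrzA; apply/cgen_eq0.
exact: dvdz_mull.
Qed.

(** Choose integers representing the elements of the cyclic group; multiplying
    [x] by them does not depend on the choice. *)
Lemma cyc_hom (q : nat) (X : zmodType) (x : X) : x *+ q = 0 ->
  exists f : {additive cyc q -> X}, f (cgen q) = x.
Proof.
move=> xq; have [l lP] := choice (@cgen_onto q).
have key c d : cgen q *~ c = cgen q *~ d -> x *~ c = x *~ d.
  move=> /eqP; rewrite -subr_eq0 -mulrzBr => /eqP/cgen_eq0/dvdzP[m cd].
  by apply/eqP; rewrite -subr_eq0 -mulrzBr cd mulrC mulrzA -pmulrn xq mul0rz.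
have fB : zmod_morphism (fun y => x *~ l y).
  move=> y z /=; rewrite -mulrzBr; apply: key.
  by rewrite mulrzBr -!lP.
exists (additive_of fB) => /=; rewrite -[RHS]mulr1z; apply: key.
by rewrite -lP mulr1z.
Qed.

Section CyclicDecomposition.
Variable A : zmodType.

Lemma span_sumP (s : seq A) x : span s x <->
  exists c : nat -> int, x = \sum_(k < size s) s`_k *~ c k.
Proof.
elim: s x => [|g s IH] x /=.
  by split=> [->|[c ->]]; [exists (fun=> 0)|]; rewrite big_ord0.
split=> [[c /IH[d xd]]|[c ->]].
  exists (fun k => if k is k'.+1 then d k' else c).
  by rewrite big_ord_recl /= -xd addrC subrK.
exists (c 0%N); apply/IH; exists (fun k => c k.+1).
by rewrite big_ord_recl /= [X in X - _]addrC addrK.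
Qed.

Lemma indep_sum (s : seq (A * nat)) (c : nat -> int) : indep s ->
  \sum_(k < size s) (unzip1 s)`_k *~ c k = 0 ->
  forall k, (k < size s)%N -> (nth 0%N (unzip2 s) k %| c k)%Z.
Proof.
elim: s c => // -[g q] s IH c [/= div gq si]; rewrite big_ord_recl /= => sum0.
have c0 : (q %| c 0%N)%Z.
  apply: div; rewrite -[_ *~ _]opprK; apply/spanN/span_sumP.
  exists (fun k => c k.+1); rewrite size_map.
  by apply/eqP; rewrite eq_sym addrC -addr_eq0 in sum0 *; exact/eqP.
case=> //= k; apply: (IH (fun k => c k.+1)) => //.
have /dvdzP[m c0E] := c0.
move: sum0; rewrite c0E mulrC mulrzA -pmulrn gq mul0rz add0r => sum0.
by rewrite -[RHS]sum0.
Qed.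

Lemma indep_order (s : seq (A * nat)) k : indep s -> (k < size s)%N ->
  (unzip1 s)`_k *+ (nth 0%N (unzip2 s) k) = 0.
Proof. by elim: s k => // -[g q] s IH [|k] [/= _ gq si] //; apply: IH. Qed.

(** The coordinates on a basis of primary elements; they are only defined modulo
    the orders, which is what the cyclic groups absorb. *)
Lemma fg_cyclic : finitely_generated A ->
  exists n (q : 'I_n -> nat), (forall k, primary (q k)) /\
    isomorphic A (dprodType (fun k => cyc (q k))).
Proof.
case/fg_primary_basis=> s [si ps ss].
exists (size s), (fun k => (nth 0%N (unzip2 s) k)); split=> [k|].
  by rewrite (nth_map (0, 0%N)) //; apply/ps/mem_nth.
have /choice[c cP] x : exists c : nat -> int,
    x = \sum_(k < size s) (unzip1 s)`_k *~ c k.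
  by have /span_sumP := ss x; rewrite size_map.
have key (d : nat -> int) (k : nat) : \sum_(k < size s) (unzip1 s)`_k *~ d k = 0 ->
    (k < size s)%N -> cgen (nth 0%N (unzip2 s) k) *~ d k = 0.
  by move=> sum0 ks; apply/cgen_eq0/indep_sum.
apply: (@isomorphic_of _ _ (fun x => (fun k : 'I_(size s) =>
  cgen (nth 0%N (unzip2 s) k) *~ c x k) : dprodType _)).
- move=> x y; apply: functional_extensionality_dep => k.
  apply/eqP; rewrite -subr_eq0; apply/eqP.
  transitivity (cgen (nth 0%N (unzip2 s) k) *~ (c (x - y) k - (c x k - c y k))).
    by rewrite !mulrzBr.
  apply: (key (fun k => c (x - y) k - (c x k - c y k))) => //.
  under eq_bigr do rewrite !mulrzBr.
  by rewrite !sumrB -!cP subrr.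
- move=> x cx; rewrite (cP x) big1 // => k _.
  have := congr1 (fun z : dprodType _ => z k) cx => /= /cgen_eq0/dvdzP[m ->].
  by rewrite mulrC mulrzA -pmulrn indep_order // mul0rz.
- move=> y; have /choice[d dP] (k : 'I_(size s)) := cgen_onto (y k).
  pose x := \sum_(k < size s) (unzip1 s)`_k *~ d k; exists x.
  apply: functional_extensionality_dep => k.
  apply/eqP; rewrite -subr_eq0 [X in _ - X]dP -mulrzBr; apply/eqP.
  pose d' k := if insub k is Some k' then d k' else 0.
  have d'E (j : 'I_(size s)) : d' j = d j by rewrite /d' valK.
  rewrite -d'E; apply: (key (fun k => c x k - d' k)) => //.
  under eq_bigr do rewrite mulrzBr.
  rewrite sumrB -cP; under eq_bigr do rewrite d'E.
  by rewrite subrr.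
Qed.

End CyclicDecomposition.

(** * Self-smallness and slenderness *)

Lemma seq_of_infinite (I : Type) (P : set I) : infinite_set P ->
  exists s : nat -> I, injective s /\ forall n, P (s n).
Proof.
elim/Ppointed: I => I in P *; first by rewrite emptyE => /infinite_setN0[].
move=> /infiniteP/ppcard_leP[f]; exists f; split=> [m n fmn|n].
  by apply: (@inj _ _ setT f) => //; rewrite inE.
exact: (@funS _ _ setT P f).
Qed.

Lemma finite_set_bounded (P : set nat) : finite_set P ->
  exists N, forall n, (N <= n)%N -> ~ P n.
Proof.
move=> /finite_seqP[s ->]; exists (\max_(k <- s) k).+1 => n sn /= ns.
by move: sn; rewrite ltnNge (@leq_bigmax_seq _ s xpredT id n ns).
Qed.

Lemma dsumP (I : Type) (A : I -> zmodType) (x y : dsumType A) :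
  (forall i, dsum_val x i = dsum_val y i) -> x = y.
Proof. by move=> xy; apply/val_inj/functional_extensionality_dep. Qed.

(** Infinitely many nonzero components of a map into a direct sum contain a
    sequence of them, so only sequences of endomorphisms matter. *)
Lemma self_smallP (M : zmodType) : self_small M <->
  forall phi : nat -> {additive M -> M},
    (forall x, exists N, forall n, (N <= n)%N -> phi n x = 0) ->
  exists n, forall x, phi n x = 0.
Proof.
split=> [ss phi phi0|crit I].
  have fs x : ((fun n => phi n x) : dprodType (fun _ : nat => M))
      \in @finsupp nat (fun=> M).
    apply/asboolP; have [N phiN] := phi0 x.
    apply: (sub_finite_set _ (finite_II N)) => n /= nx.
    by rewrite ltnNge; apply: contra nx => /phiN->.
  have FB : zmod_morphism (fun x => DSum (fs x)).
    by move=> x y; apply: dsumP => n; apply: raddfB.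
  have [g _ gK] := ss nat; have := gK (additive_of FB : homType _ _).
  case: (g _) => f /= /[dup] /asboolP/finite_set_bounded[N fN] ffin gE.
  exists N => x; have /negP := fN N (leqnn N).
  rewrite negbK => /eqP fN0.
  have := congr1 (fun h : homType M (dsumType (fun _ : nat => M)) =>
    dsum_val (h x) N) gE => /= <-.
  by rewrite fN0.
apply: inj_surj_bij => [f g fg|F].
  apply: dsumP => i; apply: homP => x.
  have : dsum_val (dsum_hom f x) i = dsum_val (dsum_hom g x) i by rewrite fg.
  by [].
have FiB i : zmod_morphism (fun x => dsum_val (F x) i).
  by move=> x y; rewrite raddfB.
pose h i : homType M M := additive_of (FiB i).
have hfin : (h : dprodType (fun _ : I => homType M M)) \in @finsupp I _.
  apply/asboolP; apply: contrapT => /seq_of_infinite[s [s_inj hs]].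
  have [|n hn] := crit (fun n => hom_fun (h (s n))) => [x|].
    have /asboolP Fx : dsum_val (F x) \in @finsupp I (fun=> M) by exact: valP.
    have /finite_set_bounded[N NP] :
        finite_set [set n | dsum_val (F x) (s n) != 0].
      by apply: finite_preimage Fx => m n _ _; apply: s_inj.
    by exists N => n /NP /negP; rewrite negbK => /eqP.
  by have /eqP := hs n; apply; apply: homP.
by exists (DSum hfin); apply: homP => x; apply: dsumP.
Qed.

Lemma self_small_isomorphic (M M' : zmodType) :
  isomorphic M M' -> self_small M' -> self_small M.
Proof.
move=> [f [g fK gK]] /self_smallP crit; apply/self_smallP => phi phi0.
have gB : zmod_morphism g.
  by move=> x y; rewrite -[in LHS](gK x) -[in LHS](gK y) -raddfB fK.
pose g' := additive_of gB.
have [x|n fn0] := crit (fun n => f \o (phi n \o g') : {additive M' -> M'}).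
  have [N phiN] := phi0 (g x); exists N => n /phiN /= ->; exact: raddf0.
exists n => x; apply: (can_inj fK); rewrite raddf0 -(fn0 (f x)) /=.
by rewrite fK.
Qed.

Lemma fct_mulrz (K : Type) (x : K -> int) (c : int) t : (x *~ c) t = x t *~ c.
Proof.
have evB : zmod_morphism (fun y : K -> int => y t) by [].
exact: (raddfMz (additive_of evB)).
Qed.

(** The group of finitely supported integer sequences is slender.  A diagonal
    argument: those sequences are countably many, say [G 0], [G 1], ...; adding
    or not a multiple of a unit vector at step [k] makes the image of the limit
    differ from [G k] modulo an integer that all later steps respect. *)
Lemma slender (f : nat -> {additive (nat -> int) -> int}) :
  (forall x, exists N, forall n, (N <= n)%N -> f n x = 0) ->
  exists m0, forall m, (m0 <= m)%N -> forall n, f n (fun k => (k == m)%:R) = 0.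
Proof.
move=> f0; apply: contrapT => /forallNP nobound.
pose e m : nat -> int := fun k => (k == m)%:R.
have big_e k : exists m n, (k <= m)%N /\ f n (e m) != 0.
  have := nobound k; move/existsNP=> [m /not_implyP[km /existsNP[n /eqP fn]]].
  by exists m, n.
pose G k n : int := nth 0 (odflt [::] (unpickle k : option (seq int))) n.
have G_onto x : exists k, forall n, f n x = G k n.
  have [N fN] := f0 x; exists (pickle [seq f n x | n <- iota 0 N]) => n.
  rewrite /G pickleK /=; have [nN|Nn] := ltnP n N.
    by rewrite (nth_map 0%N) ?size_iota // nth_iota.
  by rewrite nth_default ?fN // size_map size_iota.
(* A state is a modulus with a partial sum; step [k] keeps the sum modulo the
   old modulus and at the places below [k], and separates it from [G k] modulo
   the new one. *)
pose R k (z z' : int * (nat -> int)) := z.1 != 0 ->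
  [/\ z'.1 != 0, (z.1 %| z'.1)%Z, forall j, (z.1 %| z'.2 j - z.2 j)%Z,
      forall j, (j < k)%N -> z'.2 j = z.2 j &
      exists n, ~ (z'.1 %| f n z'.2 - G k n)%Z].
have /choice[step stepP] (kz : nat * (int * (nat -> int))) :
    exists z', R kz.1 kz.2 z'.
  case: kz => k [a s]; have [m [n [km fnm]]] := big_e k.
  (* The new modulus does not divide [a * v] because [|v| + 1] does not divide
     the nonzero [v]; hence one of the two candidate sums works. *)
  pose v := f n (e m); pose a' := a * (`|v|%N.+1)%:Z.
  have ndiv : a != 0 -> ~ (a' %| a * v)%Z.
    move=> a0; rewrite dvdz_mul2l // dvdzE => /dvdn_leq.
    by rewrite absz_gt0 fnm /= ltnn => /(_ isT).
  have em j : (j < k)%N -> e m j = 0.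
    by move=> jk; rewrite /e ltn_eqF // (leq_trans jk).
  have fe : f n (s + e m *~ a) = f n s + a * v.
    by rewrite raddfD raddfMz mulrzz mulrC.
  have sE j : (s + e m *~ a) j = s j + e m j * a.
    by rewrite -[LHS]/(s j + (e m *~ a) j) fct_mulrz mulrzz.
  have a'0 : a != 0 -> a' != 0 by move=> a0; rewrite mulf_neq0.
  have aa' : (a %| a')%Z by rewrite dvdz_mulr.
  have [d|nd] := boolP (a' %| f n s - G k n)%Z.
    exists (a', s + e m *~ a) => a0; split=> //= [|j|j jk|].
    - exact: a'0.
    - by rewrite sE addrC addKr dvdz_mull.
    - by rewrite sE em // mul0r addr0.
    - exists n; rewrite fe addrAC => d'; apply: ndiv => //.
      by rewrite -[a * v](addKr (f n s - G k n)) rpredD ?rpredN.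
  exists (a', s) => a0; split=> //= [|j|]; first exact: a'0.
    by rewrite subrr dvdz0.
  by exists n; apply/negP.
pose st := fix st k := if k is k'.+1 then step (k', st k')
  else (1, 0) : int * (nat -> int).
have st0 k : (st k).1 != 0.
  by elim: k => //= k IH; have /= [] := stepP (k, st k) IH.
have stR k := stepP (k, st k) (st0 k).
have div_a k l : ((st k).1 %| (st (k + l)%N).1)%Z.
  elim: l => [|l IH]; first by rewrite addn0.
  rewrite addnS; apply: dvdz_trans IH _; by have [] := stR (k + l)%N.
have div_s k l j : ((st k).1 %| (st (k + l)%N).2 j - (st k).2 j)%Z.
  elim: l => [|l IH]; first by rewrite addn0 subrr.
  have [_ _ /(_ j) /(dvdz_trans (div_a k l)) d _ _] := stR (k + l)%N.
  by rewrite addnS -(subrKA ((st (k + l)%N).2 j)) rpredD.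
have stab j l : (st (j.+1 + l)%N).2 j = (st j.+1).2 j.
  elim: l => [|l IH]; first by rewrite addn0.
  rewrite addnS -IH; have [_ _ _ -> //] := stR (j.+1 + l)%N.
  by rewrite addSn ltnS leq_addr.
pose x j := (st j.+1).2 j.
have div_x k j : ((st k).1 %| x j - (st k).2 j)%Z.
  have [kj|jk] := leqP k j.+1; first by rewrite /x -(subnKC kj).
  by rewrite /x -(stab j (k - j.+1)%N) subnKC ?subrr // ltnW.
have [k Gk] := G_onto x.
have [_ _ _ _ [n]] := stR k; apply; rewrite -Gk.
have /choice[z zP] : forall j, exists q, x j - (st k.+1).2 j = q * (st k.+1).1.
  by move=> j; apply/dvdzP/div_x.
have -> : step (k, st k) = st k.+1 by [].
have {1}-> : (st k.+1).2 = x - z *~ (st k.+1).1.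
  apply/funext => j; rewrite -[RHS]/(x j - (z *~ (st k.+1).1) j).
  by rewrite fct_mulrz mulrzz -zP opprB addrC subrK.
by rewrite raddfB addrAC subrr add0r raddfMz mulrzz -mulNr dvdz_mull.
Qed.

(** * Powers of the integers are self-small *)

Section IntegerPower.
Variables (K : Type) (f : nat -> {additive (K -> int) -> int}).
Hypothesis f0 : forall x, exists N, forall n, (N <= n)%N -> f n x = 0.
Implicit Types (x y : K -> int) (E : set K).

(** A family of integer vectors with finitely many nonzero entries at each
    place extends to a homomorphism from the Baer-Specker group, so slenderness
    applies to it. *)
Lemma pointwise_finite_null (y : nat -> K -> int) :
  (forall t, exists b, forall m, (b <= m)%N -> y m t = 0) ->
  exists m0, forall m, (m0 <= m)%N -> forall n, f n (y m) = 0.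
Proof.
move=> /choice[b bP].
pose S (a : nat -> int) : K -> int := fun t => \sum_(m < b t) a m * y m t.
have SB : zmod_morphism S.
  move=> a a'; apply/funext => t.
  rewrite -[RHS]/(S a t - S a' t) /S -sumrB; apply: eq_bigr => m _.
  by rewrite -mulrBl.
have Se m : S (fun k => (k == m)%:R) = y m.
  apply/funext => t; have [mb|bm] := ltnP m (b t).
    rewrite /S (bigD1 (Ordinal mb)) //= eqxx mul1r big1 ?addr0 // => k km.
    by rewrite -[(k : nat) == m]/(k == Ordinal mb) (negbTE km) mul0r.
  rewrite bP // /S big1 // => k _.
  by rewrite ltn_eqF ?mul0r // (leq_trans (ltn_ord k)).
have [a|m0 m0P] := @slender
    (fun n => f n \o additive_of SB : {additive (nat -> int) -> int}).
  by have [N fN] := f0 (S a); exists N.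
by exists m0 => m mm0 n; rewrite -Se; apply: m0P.
Qed.

Definition restrict E x : K -> int := fun t => if `[< E t >] then x t else 0.

Definition on E x := forall t, ~ E t -> x t = 0.

Lemma on_restrict E x : on E (restrict E x).
Proof. by move=> t Et; rewrite /restrict asboolF. Qed.

Lemma restrict_split E x : x = restrict E x + restrict (~` E) x.
Proof.
apply/funext => t; rewrite -[RHS]/(restrict E x t + restrict (~` E) x t).
rewrite /restrict; have [Et|Et] := pselect (E t).
  by rewrite asboolT // asboolF ?addr0 // => /(_ Et).
by rewrite asboolF // asboolT ?add0r.
Qed.

(** A set of coordinates is null if the maps ignore the vectors supported on it,
    and bad if the conclusion sought fails for these vectors. *)
Definition null E := forall x, on E x -> forall n, f n x = 0.

Definition bad E := forall N, exists n x, [/\ (N <= n)%N, on E x & f n x != 0].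

Lemma nullU E E' : null E -> null E' -> null (E `|` E').
Proof.
move=> nE nE' x xEE' n; rewrite (restrict_split E x) raddfD.
rewrite (nE _ (on_restrict _)) (nE' _ _) ?addr0 // => t E't.
rewrite /restrict; have [Et|Et] := pselect (E t).
  by rewrite asboolF // => /(_ Et).
by rewrite asboolT // xEE' // => -[].
Qed.

Lemma not_bad E : ~ bad E ->
  exists N, forall n x, (N <= n)%N -> on E x -> f n x = 0.
Proof.
move=> /existsNP[N NP]; exists N => n x Nn Ex; apply: contrapT => /eqP fnx.
by apply: NP; exists n, x.
Qed.

Lemma bad_split E E' : E' `<=` E -> bad E -> ~ bad E' -> bad (E `\` E').
Proof.
move=> E'E badE /not_bad[N NP]; apply: contrapT => /not_bad[N' NP'].
have [n [x [Nn Ex /eqP]]] := badE (maxn N N'); apply.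
move: Nn; rewrite geq_max => /andP[Nn Nn'].
rewrite (restrict_split E' x) raddfD NP ?NP' ?addr0 //.
  move=> t; rewrite /restrict => tEE'; case: asboolP => // tE'.
  by apply: Ex => tE; apply: tEE'.
exact: on_restrict.
Qed.

(** If a bad set could always be split into a bad part and a part that is not
    null, infinitely many disjoint sets would carry vectors that the maps do
    not all kill, against [pointwise_finite_null]. *)
Lemma bad_atom : bad setT -> exists E, bad E /\
  forall E', E' `<=` E -> null E' \/ null (E `\` E').
Proof.
move=> badT; apply: contrapT => /forallNP noatom.
have /choice[step stepP] : forall E, exists Ex : set K * (K -> int), bad E ->
    [/\ bad Ex.1, Ex.1 `<=` E, on (E `\` Ex.1) Ex.2 & exists n, f n Ex.2 != 0].
  move=> E; have [badE|] := pselect (bad E); last by exists (E, 0).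
  have /existsNP[E' /not_implyP[E'E /not_orP[nE' nEE']]] : ~ forall E',
      E' `<=` E -> null E' \/ null (E `\` E').
    by move=> at_E; apply: (noatom E).
  have not_null D : ~ null D -> exists2 x, on D x & exists n, f n x != 0.
    move=> /existsNP[x /not_implyP[Dx /existsNP[n /eqP fnx]]].
    by exists x => //; exists n.
  have [badE'|nbadE'] := pselect (bad E').
    have [x Dx fx] := not_null _ nEE'; by exists (E', x).
  have [x Dx fx] := not_null _ nE'; exists (E `\` E', x) => _; split=> //=.
  - exact: bad_split.
  - by move=> t ED; apply: Dx => tE'; apply: ED; split; [exact: E'E|case].
pose D := fix D k := if k is k'.+1 then (step (D k')).1 else setT.
have badD k : bad (D k) by elim: k => //= k /stepP[].
have DS k l : D (k + l)%N `<=` D k.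
  elim: l => [|l IH]; first by rewrite addn0.
  by rewrite addnS => t Dt; apply: IH; have [_ + _ _] := stepP _ (badD (k + l)%N);
    apply.
pose y k := (step (D k)).2.
have y_on k : on (D k `\` D k.+1) (y k) by have [] := stepP _ (badD k).
have [t|m0 m0P] := @pointwise_finite_null y.
  have [[k Dk]|noD] := pselect (exists k, ~ D k t).
    exists k => m km; apply: y_on => -[Dm _]; apply: Dk.
    by move: Dm; rewrite -(subnKC km) => /DS.
  exists 0%N => m _; apply: y_on => -[_]; apply.
  by apply: contrapT => nD; apply: noD; exists m.+1.
have [_ _ _ [n /eqP]] := stepP _ (badD m0); apply; exact: m0P.
Qed.

(** Either the complement in [E] of some level set of [x] is null, and the maps
    see a constant vector, or all level sets are null; as these are countably
    many, slenderness then makes [x] itself invisible. *)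
Lemma atom_constant E x :
  (forall E', E' `<=` E -> null E' \/ null (E `\` E')) -> on E x ->
  exists c, forall n, f n x = c * f n (restrict E (fun=> 1)).
Proof.
move=> atomE Ex; pose L c := [set t | E t /\ x t = c].
have LE c : L c `<=` E by move=> t [].
have [[c nc]|allnull] := pselect (exists c, null (E `\` L c)).
  exists c => n; apply/eqP; rewrite -subr_eq0; apply/eqP.
  rewrite mulrC -mulrzz -raddfMz -raddfB; apply: nc => t ELt.
  rewrite -[LHS]/(x t - (restrict E (fun=> 1) *~ c) t) fct_mulrz /restrict.
  have [Et|Et] := pselect (E t).
    rewrite asboolT // intz; have [|xtc] := pselect (x t = c).
      by move->; rewrite subrr.
    by case: ELt; split=> // -[].
  by rewrite asboolF // mul0rz subr0 Ex.
have nullL c : null (L c).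
  by have [//|nc] := atomE _ (LE c); case: allnull; exists c.
exists 0 => n; rewrite mul0r.
pose B m := [set t | E t /\ (`|x t|%N < m)%N].
have nullB m : null (B m).
  elim: m => [|m IH]; first by move=> z Bz k; rewrite (_ : z = 0) ?raddf0 //;
    apply/funext => t; apply: Bz => -[].
  have -> : B m.+1 = B m `|` (L m%:Z `|` L (- m%:Z)).
    apply/seteqP; split=> [t [Et]|t [[Et xm]|[[Et xm]|[Et xm]]]]; last 3 first.
    - by split=> //; rewrite ltnS ltnW.
    - by split=> //; rewrite xm.
    - by split=> //; rewrite xm abszN.
    rewrite ltnS leq_eqVlt => /orP[/eqP xm|xm]; last by left.
    right; move: xm; case xt: (x t) => [k|k] /= <-; [left|right]; split=> //.
  by do 2!apply: nullU => //.
have [t|m /(_ m (leqnn m)) fm] :=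
    @pointwise_finite_null (fun m => restrict (~` B m) x).
  exists `|x t|%N.+1 => m xm; rewrite /restrict.
  have [Et|Et] := pselect (E t); last by rewrite Ex // if_same.
  by rewrite asboolF // => /(_ (conj Et xm)).
rewrite (restrict_split (B m) x) raddfD fm addr0.
exact: (nullB m _ (@on_restrict _ _)).
Qed.

(** On a bad atom the maps only see the constant vector 1, which almost all of
    them kill, so the atom is not bad. *)
Lemma integer_power_finite :
  exists N, forall n x, (N <= n)%N -> f n x = 0.
Proof.
have [badT|/not_bad[N NP]] := pselect (bad setT); last first.
  by exists N => n x Nn; apply: NP => // t /(_ I).
have [E [badE atomE]] := bad_atom badT.
have [N NP] := f0 (restrict E (fun=> 1)).
have [n [x [Nn Ex /eqP]]] := badE N; case.
by have [c ->] := atom_constant atomE Ex; rewrite NP ?mulr0.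
Qed.

End IntegerPower.

Lemma self_small_integer_power (K : Type) : self_small (K -> int).
Proof.
apply/self_smallP => phi phi0; apply: contrapT => /forallNP nz.
have /choice[k kP] n : exists k, exists x, phi n x k != 0.
  apply: contrapT => /forallNP nk; apply: (nz n) => x; apply/funext => k.
  by apply: contrapT => /eqP xk; apply: (nk k); exists x.
have fB n : zmod_morphism (fun x => phi n x (k n)).
  by move=> x y; rewrite raddfB.
have [x|N NP] := @integer_power_finite K (fun n => additive_of (fB n)).
  by have [N phiN] := phi0 x; exists N => n /phiN /= ->.
have [x /eqP] := kP N; apply; exact: NP.
Qed.

(** * Products of finite p-groups and a free group are self-small *)

Section Single.
Variables (I : Type) (A : I -> zmodType).

(** The index type has no decidable equality, so equality of indices is decided
    classically and the value transported along it. *)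
Definition single (i : I) (a : A i) : dprodType A := fun j =>
  if pselect (i = j) is left e then eq_rect i (fun k => A k : Type) a j e else 0.

Lemma single_same i (a : A i) : single a i = a.
Proof.
rewrite /single; case: pselect => // e.
by rewrite (Prop_irrelevance e erefl).
Qed.

Lemma single_other i j (a : A i) : i <> j -> single a j = 0.
Proof. by rewrite /single; case: pselect. Qed.

Lemma single_zmod_morphism i : zmod_morphism (@single i).
Proof.
move=> a b; apply: functional_extensionality_dep => j.
rewrite -[RHS]/(single a j - single b j).
have [ij|ij] := pselect (i = j); last by rewrite !single_other // subrr.
by case: _ / ij; rewrite !single_same.
Qed.

HB.instance Definition _ i := GRing.isZmodMorphism.Build (A i) (dprodType A)
  (@single i) (@single_zmod_morphism i).

Lemma dprodB (x y : dprodType A) i : (x - y) i = x i - y i.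
Proof. by []. Qed.

Lemma dprod_mulrn (x : dprodType A) n i : (x *+ n) i = x i *+ n.
Proof.
by elim: n => // n IH; rewrite !mulrS -[LHS]/(x i + (x *+ n) i) IH.
Qed.

Lemma dprod_mulrz (x : dprodType A) (c : int) i : (x *~ c) i = x i *~ c.
Proof.
case: c => n; first exact: dprod_mulrn.
by rewrite NegzE !mulrNz -[LHS]/(- (x *+ n.+1) i) dprod_mulrn.
Qed.

End Single.

Lemma coprime_divisible (X : zmodType) (y : X) m n :
  y *+ m = 0 -> coprime n m -> exists z, y = z *+ n.
Proof.
move=> ym; case: n => [|n nm].
  rewrite /coprime gcd0n => /eqP m1; exists 0.
  by rewrite m1 mulr1n in ym; rewrite ym mul0rn.
case: (@egcdnP n.+1 m isT) => u v uv _.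
exists (y *+ u); rewrite -mulrnA uv (eqP nm) mulrnDr mulr1n.
by rewrite mulnC mulrnA ym mul0rn add0r.
Qed.

Section PrimaryProduct.
Variable Mp : primes_type -> finZmodType.
Hypothesis Mp_pgroup : forall p : primes_type, ((sval p).-group [set: Mp p]%SET)%g.
Let P : zmodType := dprodType (fun p => Mp p : zmodType).
Notation at_prime y := (single (A := fun p => Mp p : zmodType) y).

Lemma pgroup_exponent p : exists e, forall y : Mp p, y *+ (sval p ^ e) = 0.
Proof.
have := card_pgroup (Mp_pgroup p); set e := logn _ _ => card; exists e => y.
by rewrite -card -FinRing.zmodXgE expg_cardG // inE.
Qed.

Lemma product_divisible (p : primes_type) (x : P) k :
  x p = 0 -> exists z : P, x = z *+ (sval p ^ k).
Proof.
move=> xp; have div q : exists z : Mp q, x q = z *+ (sval p ^ k).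
  have [<-|qp] := pselect (p = q); first by exists 0; rewrite xp mul0rn.
  have [e eP] := pgroup_exponent q.
  apply: coprime_divisible (eP _) _; apply/coprimeXl/coprimeXr.
  rewrite prime_coprime; last exact: (svalP p).
  rewrite dvdn_prime2; [|exact: (svalP p)|exact: (svalP q)].
  by apply/eqP => /val_inj.
exists (fun q => projT1 (cid (div q))); apply: functional_extensionality_dep => q.
by rewrite dprod_mulrn; exact: (projT2 (cid (div q))).
Qed.

Lemma product_split (p : primes_type) (x : P) k :
  exists z : P, x = at_prime (x p) + z *+ (sval p ^ k).
Proof.
have [|z zE] := @product_divisible p (x - single (x p)) k.
  by rewrite dprodB single_same subrr.
by exists z; rewrite -zE addrC subrK.
Qed.

(** The image of an element is divisible by every prime, up to torsion, which
    an integer cannot be unless it vanishes. *)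
Lemma product_hom_int (h : {additive P -> int}) x : h x = 0.
Proof.
apply: contrapT => /eqP hx0.
have [p hxp pp] := prime_above `|h x|.
have [e eP] := pgroup_exponent (exist _ p pp).
have [z /= xE] := product_split (exist _ p pp) x 1.
move: hxp; rewrite ltnNge dvdn_leq ?absz_gt0 // -[p]/(`|p%:Z|%N) -dvdzE.
rewrite xE raddfD raddfMn expn1 /= (_ : h _ = 0).
  by rewrite add0r -mulr_natr dvdz_mull // natz.
set y := single _; have : h y *+ (p ^ e) = 0.
  by rewrite -raddfMn /y -raddfMn [_ *+ _]eP !raddf0.
move/eqP; rewrite Num.Theory.mulrn_eq0 expn_eq0 => /orP[/andP[/eqP p0]|/eqP //].
by have := prime_gt0 pp; rewrite p0.
Qed.

Lemma product_hom_free (F : zmodType) (h : {additive P -> F}) x :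
  free_group F -> h x = 0.
Proof.
case=> B [g [g' gK g'K]]; apply: (can_inj gK); rewrite raddf0.
apply: dsumP => b.
have hB : zmod_morphism (fun y => dsum_val (g (h y)) b).
  by move=> y z; rewrite !raddfB.
exact: (product_hom_int (additive_of hB)).
Qed.

(** The other components form a group divisible by all powers of [p], so they
    map to zero in the finite [p]-group [Mp p]. *)
Lemma product_hom_component (h : {additive P -> P}) x p :
  h x p = h (at_prime (x p)) p.
Proof.
have [e eP] := pgroup_exponent p.
have [z {1}->] := product_split p x e.
rewrite raddfD raddfMn.
by rewrite -[LHS]/(h _ p + (h z *+ _) p) dprod_mulrn eP addr0.
Qed.

(** Each component is finite, so only finitely many maps of the sequence are
    nonzero on it; an element whose component at each prime is not killed by the
    last of these maps is not killed by infinitely many maps. *)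
Lemma self_small_mixed (F : zmodType) :
  finitely_generated F -> free_group F -> self_small (F * P)%type.
Proof.
case=> k [g gen] freeF; apply/self_smallP => phi phi0.
apply: contrapT => /forallNP nz.
have inlB : zmod_morphism (fun y : F => (y, 0) : F * P).
  by move=> y z; congr (_, _); rewrite subr0.
have inrB : zmod_morphism (fun x : P => (0, x) : F * P).
  by move=> y z; congr (_, _); rewrite subr0.
pose il := additive_of inlB; pose ir := additive_of inrB.
have [N0 N0P] : exists N, forall n y, (N <= n)%N -> phi n (y, 0) = 0.
  have /choice[N NP] (i : 'I_k) := phi0 (g i, 0).
  exists (\max_i N i)%N => n y mn; have [c ->] := gen y.
  rewrite -[(_, _)]/(il _) -[LHS]/((phi n \o il) _) raddf_sum big1 // => i _.
  rewrite raddfMz /= NP ?mul0rz //.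
  by apply: leq_trans mn; apply: (leq_bigmax i).
pose psi n : {additive P -> P} := snd \o (phi n \o ir).
have psi0 x : exists N, forall n, (N <= n)%N -> psi n x = 0.
  by have [N NP] := phi0 (0, x); exists N => n Nn; rewrite /psi /= NP.
have psi_nz n : (N0 <= n)%N ->
    exists p (y : Mp p), psi n (at_prime y) p <> 0 :> Mp p.
  move=> Nn; apply: contrapT => /forallNP psi0n; apply: (nz n) => -[y x].
  have -> : (y, x) = (y, 0) + (0, x) :> F * P.
    by congr (_, _); rewrite ?addr0 ?add0r.
  rewrite raddfD N0P // add0r.
  rewrite [LHS]surjective_pairing; congr (_, _).
    exact: (@product_hom_free F (fst \o (phi n \o ir)) x).
  apply: functional_extensionality_dep => p.
  rewrite -[LHS]/(psi n x p) product_hom_component.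
  by apply: contrapT => nzp; apply: (psi0n p); exists (x p).
have /choice[b bP] p : exists b, forall n (y : Mp p), (b <= n)%N ->
    psi n (at_prime y) = 0.
  have /choice[N NP] y := psi0 (at_prime (y : Mp p)).
  exists (\max_y N y)%N => n y mn; apply: NP.
  by apply: leq_trans mn; apply: (leq_bigmax y).
have top p : exists y : Mp p, forall n (z : Mp p),
    psi n (at_prime z) p <> 0 :> Mp p ->
  exists2 n', (n <= n')%N &
    psi n' (at_prime y) p <> 0 :> Mp p.
  pose D n := `[< exists z : Mp p,
    psi n (at_prime z) p <> 0 :> Mp p >].
  have [exD|noD] := pselect (exists n, D n); last first.
    by exists 0 => n z nz0; case: noD; exists n; apply/asboolP; exists z.
  have Db n : D n -> (n <= b p)%N.
    move=> /asboolP[z]; apply: contra_notT; rewrite -ltnNge => bn.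
    by rewrite bP // ltnW.
  case: (ex_maxnP exD Db) => n' /asboolP[y yP] maxn'.
  by exists y => n z nz0; exists n' => //; apply: maxn'; apply/asboolP; exists z.
pose x : P := fun p => projT1 (cid (top p)).
have [N NP] := psi0 x.
have [p [y yP]] := psi_nz (maxn N N0) (leq_maxr _ _).
have [n' n'N] := projT2 (cid (top p)) _ _ yP; apply.
have := product_hom_component (psi n') x p; rewrite /x => <-; rewrite NP //.
by apply: leq_trans n'N; apply: leq_maxl.
Qed.

End PrimaryProduct.

(** * Complements modulo a prime *)

Definition subgroup (V : zmodType) (W : set V) :=
  W 0 /\ forall x y, W x -> W y -> W (x - y).

Section Subgroup.
Variables (V : zmodType) (W : set V).
Hypothesis subW : subgroup W.

Lemma subgroupN x : W x -> W (- x).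
Proof. by move=> Wx; rewrite -[- x]add0r; case: subW => W0; apply. Qed.

Lemma subgroupD x y : W x -> W y -> W (x + y).
Proof.
by move=> Wx Wy; rewrite -[y]opprK; case: subW => _; apply => //; apply: subgroupN.
Qed.

Lemma subgroupMz x c : W x -> W (x *~ c).
Proof.
move=> Wx; have nat_case n : W (x *+ n).
  by elim: n => [|n IH]; [case: subW|rewrite mulrS; apply: subgroupD].
by case: c => n; [apply: nat_case|apply/subgroupN/nat_case].
Qed.

End Subgroup.

(** Zorn's lemma for subgroups that contain [B] and avoid [X]; a new element
    must then generate, with the maximal subgroup, an element of [X]. *)
Lemma maximal_subgroup (V : zmodType) (B X : set V) :
  subgroup B -> (forall x, B x -> ~ X x) ->
  exists W, [/\ subgroup W, B `<=` W, forall x, W x -> ~ X x &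
    forall v, ~ W v -> exists w c, W w /\ X (w + v *~ c)].
Proof.
move=> subB BX.
pose Q (W : set V) := subgroup W /\ forall x, W x -> ~ X x.
have [F FQ Ftot|U [[subW WX] Umax]] :=
    @Zorn_bigcup V [set U : set V | Q (U `|` B)].
  have pair x y : (\bigcup_(U in F) U `|` B) x -> (\bigcup_(U in F) U `|` B) y ->
      exists W, [/\ Q W, W x, W y & W `<=` \bigcup_(U in F) U `|` B].
    have sub U : F U -> U `|` B `<=` \bigcup_(U in F) U `|` B.
      by move=> FU z [Uz|Bz]; [left; exists U|right].
    move=> [[U FU Ux]|Bx] [[U' FU' Uy]|By].
    - have [UU'|U'U] := Ftot _ _ FU FU'.
        exists (U' `|` B); split; [exact: FQ|left; exact: UU'|by left|exact: sub].
      exists (U `|` B); split; [exact: FQ|by left|left; exact: U'U|exact: sub].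
    - exists (U `|` B); split; [exact: FQ|by left|by right|exact: sub].
    - exists (U' `|` B); split; [exact: FQ|by right|by left|exact: sub].
    - by exists B; split=> // z; right.
  split; first split; first by right; case: subB.
    by move=> x y /pair/[apply] -[W [[[_ WB] _] Wx Wy]]; apply; apply: WB.
  by move=> x /[dup] /pair/[apply] -[W [[_ WX] Wx _ _]]; apply: WX.
set W := U `|` B in subW WX; exists W; split=> // [x|v nWv]; first by right.
apply: contrapT => noX.
pose W' := [set z | exists w c, W w /\ z = w + v *~ c].
have WW' : W `<=` W' by move=> w Ww; exists w, 0; rewrite mulr0z addr0.
have W'v : W' v.
  by exists 0, 1; rewrite mulr1z add0r; split=> //; case: subW.
have QW' : Q W'.
  split; [split; first by apply: WW'; case: subW|].
    move=> _ _ [w [c [Ww ->]]] [w' [c' [Ww' ->]]].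
    exists (w - w'), (c - c'); split; first by case: subW => _; apply.
    by rewrite mulrzBr opprD addrACA.
  by move=> _ [w [c [Ww ->]]] Xwv; apply: noX; exists w, c.
apply: (Umax W'); last first.
  rewrite /=; suff -> : W' `|` B = W' by [].
  by apply/seteqP; split=> [x [//|Bx]|x]; [apply: WW'; right|left].
split; last by move=> W'U; apply: nWv; left; apply: W'U.
by move=> x Ux; apply: WW'; left.
Qed.

(** Elements independent modulo [p] extend, by Zorn's lemma, to a basis
    modulo [p]; the coordinates on them yield homomorphisms of which only
    finitely many are nonzero at each element. *)
Lemma dual_sequence (V X : zmodType) (p : nat) (e : nat -> V) (x : X) :
  prime p -> x *+ p = 0 ->
  (forall N (c : nat -> int) y, \sum_(n < N) e n *~ c n = y *+ p ->
    forall n, (n < N)%N -> (p %| c n)%Z) ->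
  exists phi : nat -> {additive V -> X},
    (forall v, exists N, forall n, (N <= n)%N -> phi n v = 0) /\
    (forall n, phi n (e n) = x).
Proof.
move=> pp xp indep_e.
(* [W] will be a complement of the span of the [e n] that contains [p V]: it
   avoids every combination of them with a coefficient prime to [p]. *)
pose B := [set v : V | exists y, v = y *+ p].
pose Y := [set v : V | exists N (c : nat -> int),
  v = \sum_(n < N) e n *~ c n /\ exists2 n, (n < N)%N & ~ (p %| c n)%Z].
have [||W [subW BW WY Wmax]] := @maximal_subgroup V B Y.
- split; first by exists 0; rewrite mul0rn.
  by move=> _ _ [y ->] [z ->]; exists (y - z); rewrite mulrnBl.
- move=> _ [y ->] [N [c [yE [n nN]]]]; apply.
  by apply: (indep_e N c y).
have trunc N N' (c : nat -> int) : (N <= N')%N ->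
    (forall n, (N <= n)%N -> c n = 0) ->
    \sum_(n < N') e n *~ c n = \sum_(n < N) e n *~ c n.
  move=> NN' c0; rewrite -(subnKC NN') big_split_ord /= [X in _ + X]big1 ?addr0 //.
  by move=> n _; rewrite c0 ?mulr0z // leq_addr.
have rep v : exists Nc : nat * (nat -> int),
    (forall n, (Nc.1 <= n)%N -> Nc.2 n = 0) /\
    W (v - \sum_(n < Nc.1) e n *~ Nc.2 n).
  have [Wv|nWv] := pselect (W v).
    by exists (0%N, fun=> 0); rewrite big_ord0 subr0.
  have [w [k [Ww [N [c [wvE [n nN pcn]]]]]]] := Wmax v nWv.
  have pk : coprimez p k.
    rewrite /coprimez /= /gcdz absz_nat -[(_ == _)]/(coprime p `|k|) prime_coprime //.
    apply/negP => pk; apply: (WY (w + v *~ k)); last by exists N, c; split=> //; exists n.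
    apply: subgroupD => //; have /dvdzP[q ->] : (p %| k)%Z by rewrite dvdzE.
    by apply: BW; exists (v *~ q); rewrite mulrzA -pmulrn.
  have [a [b]] := Bezoutz p k; rewrite (eqP pk) => ab.
  exists (N, fun n => if (n < N)%N then c n * b else 0); split=> /= [m|].
    by move=> Nm; rewrite ltnNge Nm.
  have -> : \sum_(n < N) e n *~ (if (n < N)%N then c n * b else 0)
      = (w + v *~ k) *~ b.
    rewrite wvE mulrz_suml; apply: eq_bigr => m _.
    by rewrite ltn_ord mulrzA.
  have -> : v - (w + v *~ k) *~ b = (v *~ a) *+ p - w *~ b.
    rewrite mulrzDl -{1}[v]mulr1z -ab mulrzDr opprD addrACA addrC.
    by rewrite [b * k]mulrC !mulrzA subrr add0r.
  case: (subW) => _; apply; last exact: subgroupMz.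
  by apply: BW; exists (v *~ a).
have /choice[Nc NcP] := rep; pose N v := (Nc v).1; pose c v := (Nc v).2.
have c0 v n : (N v <= n)%N -> c v n = 0 by case: (NcP v) => + _; apply.
have key (d : nat -> int) L : (forall n, (L <= n)%N -> d n = 0) ->
    W (\sum_(n < L) e n *~ d n) -> forall n, x *~ d n = 0.
  move=> d0 Wd n; have [Ln|nL] := leqP L n; first by rewrite d0 ?mulr0z.
  have /dvdzP[q ->] : (p %| d n)%Z.
    apply: contrapT => pdn; apply: (WY _ Wd).
    by exists L, d; split=> //; exists n.
  by rewrite mulrC mulrzA -pmulrn xp mul0rz.
have phiB n : zmod_morphism (fun v => x *~ c v n).
  move=> u v; apply/eqP; rewrite -subr_eq0 -!mulrzBr; apply/eqP.
  pose L := maxn (N (u - v)) (maxn (N u) (N v)).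
  have Le z : z \in [:: u; v; u - v] -> (N z <= L)%N.
    by rewrite !inE /L => /or3P[] /eqP->; rewrite !leq_max leqnn ?orbT.
  apply: (key (fun n => c (u - v) n - (c u n - c v n)) L) => [m Lm|].
    by rewrite !c0 ?subr0 //; apply: leq_trans Lm; apply: Le; rewrite !inE eqxx ?orbT.
  under eq_bigr do rewrite !mulrzBr.
  rewrite !sumrB.
  have trL z : z \in [:: u; v; u - v] ->
      \sum_(n < L) e n *~ c z n = \sum_(n < N z) e n *~ c z n.
    by move=> zL; apply: trunc; [exact: Le|move=> m; apply: c0].
  rewrite !trL ?inE ?eqxx ?orbT //.
  have [_ Wu] := NcP u; have [_ Wv] := NcP v; have [_ Wuv] := NcP (u - v).
  have := (proj2 subW) _ _ ((proj2 subW) _ _ Wu Wv) Wuv.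
  set su := \sum_(n < N u) _; set sv := \sum_(n < N v) _.
  set sw := \sum_(n < N (u - v)) _.
  have -> : (u - su) - (v - sv) = (u - v) - (su - sv).
    by rewrite !opprD addrACA.
  by rewrite [- (u - v - sw)]opprB addrC addrA subrK.
exists (fun n => additive_of (phiB n)); split=> [v|n] /=.
  by exists (N v) => n /c0 ->; rewrite mulr0z.
apply/eqP; rewrite -[X in _ == X]mulr1z -subr_eq0 -mulrzBr; apply/eqP.
pose L := maxn (N (e n)) n.+1.
have := key (fun k => c (e n) k - (k == n)%:R) L _ _ n.
rewrite eqxx; apply=> [k|].
  rewrite geq_max => /andP[Nk nk].
  by rewrite c0 // gtn_eqF ?subrr.
under eq_bigr do rewrite mulrzBr.
rewrite sumrB (trunc (N (e n)) L (c (e n))) ?leq_maxl //; last first.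
  by move=> k; apply: c0.
have nL : (n < L)%N by rewrite leq_maxr.
rewrite [X in _ - X](bigD1 (Ordinal nL)) //= eqxx mulr1z [X in e n + X]big1; last first.
  by move=> k kn; rewrite -[(k : nat) == n]/(k == Ordinal nL) (negbTE kn) mulr0z.
by rewrite addr0 -opprB; apply: subgroupN => //; case: (NcP (e n)).
Qed.

(** * Divisibility of the members of a self-small product *)

Lemma coprime_kill (X : zmodType) (x : X) m n :
  coprime m n -> x *+ m = 0 -> x *+ n = 0 -> x = 0.
Proof.
move=> mn xm xn; have [u [v uv]] := Bezoutz m n.
have mn1 : gcdz m n = 1 by apply/eqP; exact: mn.
by rewrite -[x]mulr1z -mn1 -uv mulrzDr [u * _]mulrC [v * _]mulrC !mulrzA -!pmulrn
  xm xn !mul0rz addr0.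
Qed.

Lemma prime_order (X : zmodType) (x : X) n : (0 < n)%N -> x *+ n = 0 -> x != 0 ->
  exists p k, [/\ prime p, (p %| n)%N, x *+ k != 0 & x *+ k *+ p = 0].
Proof.
have [m] := ubnP n; elim: m n x => // m IHm n x nm n0 xn x0.
have n1 : (1 < n)%N.
  rewrite ltn_neqAle n0 andbT; apply: contraNneq x0 => n1.
  by rewrite -n1 mulr1n in xn; rewrite xn.
have pp := pdiv_prime n1; have pn := pdiv_dvd n; set p := pdiv n in pp pn.
have xnp : x *+ (n %/ p)%N *+ p = 0 by rewrite -mulrnA divnK.
have [xnp0|xnp0] := eqVneq (x *+ (n %/ p)%N) 0; last by exists p, (n %/ p)%N.
have [|||//|q [k [qp qn xk xkq]]] := IHm (n %/ p)%N x.
- by have := ltn_Pdiv (prime_gt1 pp) n0; move/leq_trans; apply.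
- by rewrite divn_gt0 ?prime_gt0 // dvdn_leq.
- by [].
by exists q, k; split=> //; apply: dvdn_trans qn (dvdn_div pn).
Qed.

Lemma finite_dprod (I : Type) (A : I -> zmodType) (J : set I)
    (T : forall i, set (A i)) :
  finite_set J -> (forall i, T i 0) -> (forall i, finite_set (T i)) ->
  finite_set [set x : dprodType A |
    (forall i, ~ J i -> x i = 0) /\ forall i, T i (x i)].
Proof.
elim/Pchoice: I => I in A J T *; move=> /finite_seqP[s ->] T0 Tfin.
elim: s => [|i s IH].
  apply: (sub_finite_set _ (finite_set1 0)) => x [x0 _].
  by apply: functional_extensionality_dep => i; apply: x0.
have := finite_image2 (fun a x => single a + x) (Tfin i) IH.
apply: sub_finite_set => x [x0 xT]; exists (x i); first exact: xT.
exists (x - single (x i)); last by rewrite addrC subrK.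
split=> j; rewrite dprodB; have [ij|ij] := pselect (i = j);
  try by rewrite single_other // subr0 => ?; apply: x0; rewrite /= inE;
    apply/negP/norP; split; [apply/eqP => /esym|apply/negP].
- by case: _ / ij => _; rewrite single_same subrr.
- by case: _ / ij; rewrite single_same subrr.
- by rewrite single_other // subr0.
Qed.

Section FinitelyGenerated.
Variable A : zmodType.
Hypothesis fgA : finitely_generated A.

Lemma fg_span_of (B : zmodType) (s : seq B) :
  (forall x, span s x) -> finitely_generated B.
Proof.
move=> ss; exists (size s), (fun k => s`_k) => x.
by have /span_sumP[c ->] := ss x; exists (fun k => c k).
Qed.

Lemma fg_has_span : exists s : seq A, forall x, span s x.
Proof. by have [s [_ _ ss]] := fg_primary_basis fgA; exists (unzip1 s). Qed.

(** A [p]-divisible finitely generated group has no infinite or [p]-primary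
    cyclic summand. *)
Lemma fg_divisible (p : nat) : prime p -> (forall a : A, exists b, a = b *+ p) ->
  exists m, [/\ (0 < m)%N, coprime p m & forall a : A, a *+ m = 0].
Proof.
move=> pp div; have [n [q [_ [f [g fK gK]]]]] := fg_cyclic fgA.
have cop k : coprime p (q k).
  pose y := single (A := fun k => cyc (q k)) (cgen (q k)).
  have [b gb] := div (g y); have [c cE] := cgen_onto (f b k).
  have : cgen (q k) *~ (1 - c * p%:Z) = 0.
    rewrite mulrzBr mulr1z mulrzA -cE -pmulrn -(dprod_mulrn (f b)) -raddfMn -gb gK.
    by rewrite /y single_same subrr.
  move/cgen_eq0 => qdiv; rewrite prime_coprime //; apply/negP => pq.
  have : (p %| 1 - c * p%:Z)%Z by apply: dvdz_trans qdiv; rewrite dvdzE.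
  rewrite rpredBr ?dvdz_mull // dvdzE dvdn1 => /eqP p1.
  by move: pp; rewrite (p1 : p = 1%N).
exists (\prod_k q k)%N; split=> [||a].
- rewrite prodn_gt0 // => k; rewrite lt0n; apply/eqP => q0.
  by have := cop k; rewrite q0 /coprime gcdn0 => /eqP p1; move: pp; rewrite p1.
- by apply: (big_ind (fun m => coprime p m)) => [|x y xp yp|k _]; rewrite ?coprimen1 // coprimeMr xp.
- apply: (can_inj fK); rewrite raddfMn raddf0.
  apply: functional_extensionality_dep => k; rewrite dprod_mulrn.
  by rewrite (bigD1 k) //= mulrnA cyc_mulrn mul0rn.
Qed.

Lemma fg_torsion_finite : finite_set [set a : A | a \in torsion A].
Proof.
have [n [q [_ [f [g fK gK]]]]] := fg_cyclic fgA.
pose T k := [set y : cyc (q k) | y \in torsion (cyc (q k))].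
have Tfin k : finite_set (T k).
  rewrite /T; case: (q k) => [|m]; last exact: finite_finset.
  apply: (sub_finite_set _ (finite_set1 0)) => y /= /asboolP[d d0 /eqP].
  by rewrite Num.Theory.mulrn_eq0 gtn_eqF //= => /eqP.
have T0 k : T k 0 by apply: rpred0.
have := @finite_dprod _ (fun k => cyc (q k)) setT T finite_finset T0 Tfin.
move/(finite_image g); apply: sub_finite_set => a /= /asboolP[d d0 ad].
exists (f a) => //; split=> [k|k]; first by case.
apply/asboolP; exists d => //.
by rewrite -(dprod_mulrn (f a)) -raddfMn ad raddf0.
Qed.

End FinitelyGenerated.

Section DirectSum.
Variables (I : Type) (A : I -> zmodType).

Lemma single_finsupp i (a : A i) : single a \in @finsupp I A.
Proof.
apply/asboolP; apply: (sub_finite_set _ (finite_set1 i)) => j /= /eqP aj.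
by apply: contrapT => ji; apply: aj; apply: single_other => ij; apply: ji.
Qed.

Definition dsingle i (a : A i) : dsumType A := DSum (single_finsupp a).

Lemma dsingle_zmod_morphism i : zmod_morphism (@dsingle i).
Proof. by move=> a b; apply/val_inj; apply: (raddfB (@single I A i)). Qed.

HB.instance Definition _ i := GRing.isZmodMorphism.Build (A i) (dsumType A)
  (@dsingle i) (@dsingle_zmod_morphism i).

Lemma dsum_mulrn (x : dsumType A) n i :
  dsum_val (x *+ n) i = dsum_val x i *+ n.
Proof. by rewrite -dprod_mulrn -(raddfMn (val : dsumType A -> dprodType A)). Qed.

End DirectSum.

(** The elements with a single nonzero component generate the direct sum. *)
Lemma dsum_ind (I : Type) (A : I -> zmodType) (P : dsumType A -> Prop) : P 0 ->
  (forall x y, P x -> P y -> P (x + y)) -> (forall i a, P (@dsingle I A i a)) ->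
  forall x, P x.
Proof.
elim/Pchoice: I => I in A P *; move=> P0 PD Psingle x.
have /asboolP/finite_seqP[s xs] : dsum_val x \in @finsupp _ A by exact: valP.
have {xs} : forall i, i \notin s -> dsum_val x i = 0.
  move=> i /negP nis; apply: contrapT => /eqP xi; apply: nis.
  by have : [set i | dsum_val x i != 0] i by []; rewrite xs.
elim: s x => [|i s IH] x x0.
  by have -> : x = 0 by apply: dsumP => i; apply: x0.
rewrite -[x](subrK (dsingle (dsum_val x i))); apply: PD => //; apply: IH => j js.
rewrite -[LHS]/(dsum_val x j - single (dsum_val x i) j).
have [ij|ij] := pselect (i = j); first by case: _ / ij; rewrite single_same subrr.
rewrite single_other // subr0; apply: x0; rewrite inE negb_or js andbT.
by apply/eqP => /esym.
Qed.

Section Quotient.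
Variable S : zmodType.
Notation Q := (Quotient.quot (torsion S)).

Lemma quot_eq (x y : S) :
  (\pi_Q x = \pi_Q y)%qT <-> x - y \in torsion S.
Proof. by rewrite Quotient.idealrBE; split=> [->|/eqP]. Qed.

End Quotient.

Lemma span_map (A B : zmodType) (f : {additive A -> B}) s x :
  span s x -> span (map f s) (f x).
Proof.
elim: s x => [x ->|g s IH x [c /IH h]] /=; first exact: raddf0.
by exists c; move: h; rewrite raddfB raddfMz.
Qed.

Lemma span_finite_union (T : Type) (V : zmodType) (J : set T) (X : T -> set V) :
  finite_set J -> (forall i, J i -> exists s, X i `<=` span s) ->
  exists s, forall i, J i -> X i `<=` span s.
Proof.
elim/Pchoice: T => T in J X *; move=> /finite_seqP[r ->].
elim: r => [|i r IH] Xs; first by exists [::].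
have [|t tP] := IH; first by move=> j jr; apply: Xs; rewrite /= inE jr orbT.
have [|s sP] := Xs i; first exact: mem_head.
exists (s ++ t) => j /=; rewrite inE => /predU1P[->|/tP {}tP] v Xv.
  by apply: span_sub (sP v Xv) => g gs; apply: span_mem; rewrite mem_cat gs.
by apply: span_sub (tP v Xv) => g gt; apply: span_mem; rewrite mem_cat gt orbT.
Qed.

Section SelfSmallProduct.
Variables (I : Type) (A : I -> zmodType).
Hypothesis A_fg : forall i, finitely_generated (A i).
Let M : zmodType := dprodType A.
Let S : zmodType := dsumType A.

Definition nondivisible (p : nat) :=
  [set i | exists a : A i, forall b, a <> b *+ p].

(** Elements outside [p A i], one in each of infinitely many members, are
    independent modulo [p] in the product. *)
Lemma self_small_nondivisible p (x : M) : self_small M -> prime p ->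
  x != 0 -> x *+ p = 0 -> finite_set (nondivisible p).
Proof.
move=> /self_smallP crit pp x0 xp; apply: contrapT => /seq_of_infinite[s [s_inj]].
move=> sP; have aP n : exists a : A (s n), forall b, a <> b *+ p by exact: sP.
pose a n := projT1 (cid (aP n)).
have aN n b : a n <> b *+ p by exact: (projT2 (cid (aP n)) b).
have [|phi [phi0 phie]] := @dual_sequence M M p (fun n => single (a n)) x pp xp.
  move=> N c y sum_y n nN.
  have proj_n : zmod_morphism (fun z : M => z (s n)) by [].
  have : \sum_(k < N) additive_of proj_n (single (a k) *~ c k) = y (s n) *+ p.
    by rewrite -raddf_sum sum_y raddfMn.
  rewrite (bigD1 (Ordinal nN)) //= big1 ?addr0 => [|k kn]; last first.
    rewrite dprod_mulrz single_other ?mul0rz // => /s_inj kn'.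
    by move: kn; rewrite -val_eqE /= kn' eqxx.
  rewrite dprod_mulrz single_same => ac; apply: contrapT => /negP pc.
  have pc1 : gcdz p (c n) = 1.
    apply/eqP; rewrite /gcdz absz_nat -[_ == _]/(coprime p `|c n|).
    by rewrite prime_coprime.
  have [u [v]] := Bezoutz p (c n); rewrite pc1 => uv.
  apply: (aN n (a n *~ u + y (s n) *~ v)).
  rewrite -[LHS]mulr1z -uv mulrzDr mulrnDl mulrzA -pmulrn; congr (_ + _).
  by rewrite mulrC mulrzA ac !pmulrn -!mulrzA mulrC.
have [n phi_n] := crit phi phi0.
by move: x0; rewrite -(phie n) phi_n eqxx.
Qed.

Lemma nondivisible_pcomponent p : prime p -> finite_set (nondivisible p) ->
  finite_set (pcomponent S p).
Proof.
move=> pp finJ.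
have := @finite_dprod I A (nondivisible p) (fun i => [set a | a \in torsion (A i)])
  finJ (fun=> rpred0 _) (fun i => fg_torsion_finite (A_fg i)).
move=> /(finite_preimage (f := @dsum_val I A)) fin.
apply: sub_finite_set (fin _); last first.
  by move=> x y _ _ xy; apply: dsumP => i; rewrite xy.
move=> x [/asboolP[d d0 xd] [k xk]].
split=> i /=; last first.
  by apply/asboolP; exists d => //; rewrite -dsum_mulrn xd.
move=> /forallNP div_i; have [|m [m0 pm mA]] := fg_divisible (A_fg i) pp.
  by move=> a; apply: contrapT => nb; apply: (div_i a) => b ab; apply: nb; exists b.
apply: (coprime_kill (m := (p ^ k)%N) (n := m)) => //; first exact: coprimeXl.
by rewrite -dsum_mulrn xk.
Qed.

Lemma nondivisible_quotient p : prime p -> finite_set (nondivisible p) ->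
  finitely_generated (Quotient.quot (torsion S)).
Proof.
move=> pp finJ; pose pi := \pi_(Quotient.quot (torsion S))%qT : {additive _ -> _}.
have span_single i : nondivisible p i ->
    exists s : seq S, [set @dsingle I A i a | a in setT] `<=` span s.
  move=> _; have [s sP] := fg_has_span (A_fg i).
  exists (map (@dsingle I A i) s) => _ [a _ <-].
  exact: (@span_map _ _ (@dsingle I A i)).
have [t tJ] := span_finite_union finJ span_single.
apply: (@fg_span_of _ (map pi t)) => z.
elim/generic_quotient.quotW: z => x; rewrite -[X in span _ X]/(pi x).
elim/dsum_ind: x => [|x y sx sy|i a].
- by rewrite raddf0; apply: span0.
- by rewrite raddfD; apply: spanD.
have [Ji|Ji] := pselect (nondivisible p i); 
  first by apply: span_map; have := tJ i Ji (dsingle a); apply; exists a.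
move/forallNP: Ji => div_i; have [|m [m0 pm mA]] := fg_divisible (A_fg i) pp.
  by move=> b; apply: contrapT => nb; apply: (div_i b) => c bc; apply: nb; exists c.
suff -> : pi (dsingle a) = 0 by apply: span0.
rewrite -(raddf0 pi); apply/quot_eq; rewrite subr0; apply/asboolP; exists m => //.
by rewrite -raddfMn mA raddf0.
Qed.

End SelfSmallProduct.

(** * Torsion of the direct sum *)

Lemma isomorphic_dprod_dsum (I : Type) (A : I -> zmodType) :
  finite_set [set: I] -> isomorphic (dprodType A) (dsumType A).
Proof.
move=> finI; have fs (x : dprodType A) : x \in @finsupp I A.
  by apply/asboolP; apply: sub_finite_set finI.
apply: (@isomorphic_of _ _ (fun x : dprodType A => DSum (fs x))).
- by move=> x y; apply: dsumP.
- move=> x x0; apply: functional_extensionality_dep => i.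
  have : dsum_val (DSum (fs x)) i = dsum_val 0 i by rewrite -x0.
  by [].
- by move=> y; exists (dsum_val y); apply: dsumP.
Qed.

Lemma fg_torsion_free (A : zmodType) : finitely_generated A ->
  (forall a, a \in torsion A -> a = 0) ->
  exists n, isomorphic A (dprodType (fun _ : 'I_n => int : zmodType)).
Proof.
move=> /fg_cyclic[n [q [prim iso]]] tf; exists n; apply: isomorphic_trans (iso) _.
apply: isomorphic_dprod => k.
suff -> : q k = 0%N by apply: isomorphic_refl.
case: (prim k) => // -[p [e [pp qE]]]; case: iso => f [g fK gK].
have q0 : (0 < q k)%N by rewrite qE expn_gt0 prime_gt0.
pose y := single (A := fun k => cyc (q k)) (cgen (q k)).
have gy0 : g y = 0.
  apply: tf; apply/asboolP; exists (q k) => //; apply: (can_inj fK).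
  by rewrite raddfMn raddf0 gK /y -raddfMn cyc_mulrn raddf0.
have : cgen (q k) *~ 1 = 0.
  by rewrite mulr1z -(single_same (A := fun k => cyc (q k)) (cgen (q k)))
    -/y -(gK y) gy0 raddf0.
move/cgen_eq0; rewrite dvdzE dvdn1 absz_nat qE => /eqP q1.
by have := ltn_expl e.+1 (prime_gt1 pp); rewrite q1.
Qed.

Lemma free_torsion_free (A : zmodType) (a : A) :
  free_group A -> a \in torsion A -> a = 0.
Proof.
case=> B [f [g fK gK]] /asboolP[m m0 am]; apply: (can_inj fK); rewrite raddf0.
apply: dsumP => b; apply/eqP.
have : dsum_val (f a *+ m) b = 0 by rewrite -raddfMn am raddf0.
by move/eqP; rewrite dsum_mulrn Num.Theory.mulrn_eq0 gtn_eqF.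
Qed.

Lemma fg_torsion_exponent (B : zmodType) : finitely_generated B ->
  exists N, (0 < N)%N /\ forall b, b \in torsion B -> b *+ N = 0.
Proof.
move=> /fg_torsion_finite/finite_seqP[s sE].
have sP b : b \in torsion B -> b \in s.
  by move=> tb; have : [set a : B | a \in torsion B] b by []; rewrite sE.
have : exists N, (0 < N)%N /\ forall b, b \in s -> b \in torsion B -> b *+ N = 0.
  elim: s {sP sE} => [|c s [N [N0 NP]]]; first by exists 1%N.
  have [/asboolP[m m0 cm]|ct] := boolP (c \in torsion B).
    exists (m * N)%N; split; first by rewrite muln_gt0 m0.
    move=> b; rewrite inE => /predU1P[-> _|bs tb]; first by rewrite mulrnA cm mul0rn.
    by rewrite mulnC mulrnA NP ?mul0rn.
  exists N; split=> // b; rewrite inE => /predU1P[->|]; last exact: NP.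
  by rewrite (negbTE ct).
by case=> N [N0 NP]; exists N; split=> // b tb; apply: NP => //; apply: sP.
Qed.

(** Some multiple of [f b] has prime order [p] dividing [N], so [b] cannot be
    replaced by zero when its order is reduced to a power of [p]. *)
Lemma torsion_hom_prime (B C : zmodType) (N : nat) (f : {additive B -> C}) b :
  (0 < N)%N -> (forall c, c \in torsion C -> c *+ N = 0) ->
  b \in torsion B -> f b != 0 ->
  exists p, p \in primes N /\ exists a : B, a != 0 /\ a *+ p = 0.
Proof.
move=> N0 expN /asboolP[m m0 bm] fb.
have [|p [k [pp pN fbk fbkp]]] := prime_order N0 (expN (f b) _) fb.
  by apply/asboolP; exists m => //; rewrite -raddfMn bm raddf0.
exists p; split; first by rewrite mem_primes pp N0.
pose a := b *+ k *+ m`_p^'.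
have a0 : a != 0.
  apply: contra_neq fbk => a0.
  apply: (coprime_kill (m := p) (n := m`_p^')) => //; last first.
    have -> : f b *+ k *+ m`_p^' = f a by rewrite /a !raddfMn.
    by rewrite a0 raddf0.
  by rewrite prime_coprime // -p'natE // part_pnat.
have [||q [l [qp qp' al alq]]] := @prime_order _ a (m`_p)%N _ _ a0.
- exact: part_gt0.
- by rewrite /a -!mulrnA [(m`_p^' * _)%N]mulnC partnC // mulnC mulrnA bm mul0rn.
exists (a *+ l); split=> //.
move: qp'; rewrite p_part Euclid_dvdX // => /andP[].
by rewrite dvdn_prime2 // => /eqP <-.
Qed.

Section Implications.
Variables (I : Type) (A : I -> zmodType).
Hypothesis A_fg : forall i, finitely_generated (A i).
Let M : zmodType := dprodType A.
Let S : zmodType := dsumType A.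

(** If a prime is the order of an element of the sum, almost all members are
    divisible by it; one such prime suffices for the quotient. *)
Lemma self_small_torsion : self_small M ->
  (forall x : S, x \in torsion S -> x = 0) \/
  ((forall p : nat, prime p -> finite_set (pcomponent S p)) /\
   finitely_generated (Quotient.quot (torsion S))).
Proof.
move=> ssM; have [|tors] := pselect (forall x : S, x \in torsion S -> x = 0).
  by left.
right; have nondiv p (x : S) : prime p -> x != 0 -> x *+ p = 0 ->
    finite_set (nondivisible A p).
  move=> pp x0 xp; apply: (@self_small_nondivisible I A p (dsum_val x)) => //.
  by apply: functional_extensionality_dep => i; rewrite dprod_mulrn -dsum_mulrn xp.
split=> [p pp|].
  have [[x [x0 xp]]|nox] := pselect (exists x : S, x != 0 /\ x *+ p = 0).
    exact/nondivisible_pcomponent/(nondiv p x).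
  apply: (sub_finite_set _ (finite_set1 0)) => x [_ [k xk]].
  apply: contrapT => /eqP x0.
  have [|q [m [qp qk xm xmq]]] := prime_order _ xk x0.
    by rewrite expn_gt0 prime_gt0.
  case: nox; exists (x *+ m); split=> //.
  by move: qk; rewrite Euclid_dvdX // => /andP[]; rewrite dvdn_prime2 // => /eqP <-.
move/existsNP: tors => [x /not_implyP[/asboolP[m m0 xm] /eqP x0]].
have [q [k [qp _ xk xkq]]] := prime_order m0 xm x0.
exact: (nondivisible_quotient A_fg qp (nondiv q _ qp xk xkq)).
Qed.

Lemma finite_torsion_family p : prime p -> finite_set (pcomponent S p) ->
  finite_set [set j | exists a : A j, a != 0 /\ a *+ p = 0].
Proof.
move=> pp finS; pose supp (x : S) := [set i | dsum_val x i != 0].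
have : finite_set (\bigcup_(x in pcomponent S p) supp x).
  apply: bigcup_finite => // x _.
  by have /asboolP : dsum_val x \in @finsupp I A by exact: valP.
apply: sub_finite_set => j [a [a0 ap]]; exists (dsingle a); last first.
  by rewrite /supp /= single_same.
have dp : dsingle a *+ p = 0 by rewrite -raddfMn ap raddf0.
split; last by exists 1%N; rewrite expn1.
by apply/asboolP; exists p => //; apply: prime_gt0.
Qed.

(** Outside the finite union [F] of the supports of representatives of
    generators of the quotient, all members are torsion groups. *)
Lemma torsion_free_or_finite_hom :
  (forall x : S, x \in torsion S -> x = 0) \/
  ((forall p : nat, prime p -> finite_set (pcomponent S p)) /\
   finitely_generated (Quotient.quot (torsion S))) ->
  (forall i, free_group (A i)) \/
  (forall i, finite_set [set j | exists f : homType (A j) (A i), f != 0]).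
Proof.
case=> [tf|[finp [n [g gen]]]]; [left=> i|right=> i].
  have [|m iso] := fg_torsion_free (A_fg i).
    move=> a /asboolP[d d0 ad]; rewrite -(single_same a).
    have a0 : dsingle a = 0.
      by apply: tf; apply/asboolP; exists d => //; rewrite -raddfMn ad raddf0.
    by rewrite -[single a]/(dsum_val (dsingle a)) a0.
  exists 'I_m; apply: isomorphic_trans iso _.
  exact/isomorphic_dprod_dsum/finite_finset.
pose Q := Quotient.quot (torsion S).
have /choice[s sg] k : exists s : S, (\pi_Q s)%qT = g k.
  by elim/generic_quotient.quotW: (g k) => s; exists s.
pose F := \bigcup_(k in [set: 'I_n]) [set j | dsum_val (s k) j != 0].
have finF : finite_set F.
  apply: bigcup_finite; first exact: finite_finset.
  by move=> k _; have /asboolP : dsum_val (s k) \in @finsupp I A by exact: valP.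
have torsA j : ~ F j -> forall a : A j, a \in torsion (A j).
  move=> nFj a; have [c] := gen (\pi_Q (dsingle a))%qT.
  under eq_bigr do rewrite -sg.
  pose pi := \pi_Q%qT : {additive S -> Q}.
  have -> : \sum_k (\pi_Q (s k))%qT *~ c k = pi (\sum_k s k *~ c k).
    by rewrite raddf_sum; apply: eq_bigr => k _; rewrite raddfMz.
  move=> /quot_eq/asboolP[m m0 xm]; apply/asboolP; exists m => //.
  have projB : zmod_morphism (fun z : S => dsum_val z j) by [].
  have := congr1 (additive_of projB) xm.
  rewrite raddf0 raddfMn raddfB raddf_sum big1 ?subr0 => [|k _]; last first.
    rewrite raddfMz /=; suff -> : dsum_val (s k) j = 0 by rewrite mul0rz.
    by apply: contrapT => /eqP skj; apply: nFj; exists k.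
  by rewrite /= single_same.
have [N [N0 expN]] := fg_torsion_exponent (A_fg i).
have : finite_set (F `|` \bigcup_(p in [set p | p \in primes N])
    [set j | exists a : A j, a != 0 /\ a *+ p = 0]).
  rewrite finite_setU; split=> //; apply: bigcup_finite; first exact: finite_seq.
  move=> p /=; rewrite mem_primes => /andP[pp _].
  exact/finite_torsion_family/finp.
apply: sub_finite_set => j [f /eqP f0].
have [Fj|nFj] := pselect (F j); [by left|right].
have [b /eqP fb] : exists b, f b <> 0.
  by apply/existsNP => fb; apply: f0; apply: homP => b; apply: fb.
have [p [pN pa]] := torsion_hom_prime N0 expN (torsA j nFj b) fb.
by exists p.
Qed.

End Implications.

(** * Rearranging products *)

Lemma isomorphic_dprod_sigma (I : Type) (K : I -> Type)
    (C : forall i, K i -> zmodType) :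
  isomorphic (dprodType (fun i => dprodType (C i) : zmodType))
    (dprodType (fun l : {i & K i} => C (projT1 l) (projT2 l))).
Proof.
apply: (@isomorphic_of _ _
  (fun x : dprodType (fun i => dprodType (C i) : zmodType) =>
    (fun l => x (projT1 l) (projT2 l)) :
    dprodType (fun l : {i & K i} => C (projT1 l) (projT2 l)))) => //.
- move=> x x0; apply: functional_extensionality_dep => i.
  apply: functional_extensionality_dep => k.
  exact: (congr1 (fun z : dprodType _ => z (existT _ i k)) x0).
- move=> y; exists (fun i k => y (existT _ i k)).
  by apply: functional_extensionality_dep => -[i k].
Qed.

Lemma isomorphic_dprod_label (L T : Type) (C : L -> zmodType)
    (lab : L -> option T) :
  isomorphic (dprodType C)
    (dprodType (fun l : {l | lab l = None} => C (sval l)) *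
     dprodType (fun t => dprodType (fun l : {l | lab l = Some t} => C (sval l))
       : zmodType))%type.
Proof.
pose CN := dprodType (fun l : {l | lab l = None} => C (sval l)).
pose CS t : zmodType := dprodType (fun l : {l | lab l = Some t} => C (sval l)).
pose f (x : dprodType C) : (CN * dprodType CS)%type :=
  ((fun l => x (sval l)) : CN, (fun t l => x (sval l)) : dprodType CS).
apply: (@isomorphic_of _ _ f) => //.
- move=> x [] xN xS; apply: functional_extensionality_dep => l.
  case labl: (lab l) => [t|].
    exact: (congr1 (fun z : dprodType CS => z t (exist _ l labl)) xS).
  exact: (congr1 (fun z : CN => z (exist _ l labl)) xN).
- move=> [y z].
  exists (fun l => match lab l as o return lab l = o -> C l with
    | None => fun e => y (exist _ l e)
    | Some t => fun e => z t (exist _ l e) end erefl).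
  congr (_, _).
    apply: functional_extensionality_dep => -[l e] /=.
    move: (erefl (lab l)); case: {2 3}(lab l) => [t|] e'.
      by have := e; rewrite e'.
    by rewrite (Prop_irrelevance e e').
  apply: functional_extensionality_dep => t.
  apply: functional_extensionality_dep => -[l e] /=.
  move: (erefl (lab l)); case: {2 3}(lab l) => [t'|] e'; last first.
    by have := e; rewrite e'.
  have tt' : t = t' by apply: Some_inj; rewrite -e -e'.
  by case: _ / tt' in e' *; rewrite (Prop_irrelevance e e').
Qed.

Lemma fg_dsum (I : Type) (A : I -> zmodType) : finite_set [set: I] ->
  (forall i, finitely_generated (A i)) -> finitely_generated (dsumType A).
Proof.
move=> finI fgA.
have span_i i : setT i -> exists s : seq (dsumType A),
    [set @dsingle I A i a | a in setT] `<=` span s.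
  move=> _; have [s sP] := fg_has_span (fgA i).
  exists (map (@dsingle I A i) s) => _ [a _ <-].
  exact: (@span_map _ _ (@dsingle I A i)).
have [t tP] := span_finite_union finI span_i.
apply: (@fg_span_of _ t); apply: dsum_ind => [|x y|i a].
- exact: span0.
- exact: spanD.
- by have := tP i Logic.I (dsingle a); apply; exists a.
Qed.

Lemma fg_int : finitely_generated int.
Proof. by exists 1%N, (fun=> 1) => x; exists (fun=> x); rewrite big_ord1 intz. Qed.

(** Alias of a group with a complete list of its elements, on which the
    structure of a finite type can be declared. *)
Definition enumerated (X : zmodType) (s : seq X) of (forall x, x \in s) : Type :=
  X.

Section Enumerated.
Variables (X : zmodType) (s : seq X) (s_enum : forall x, x \in s).
Notation Y := (enumerated s_enum).

HB.instance Definition _ := GRing.Zmodule.on Y.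

Fact enumerated_pcancel :
  pcancel (fun x : Y => index (x : X) s) (fun n => onth s n : option Y).
Proof.
move=> x; rewrite onthE (nth_map (x : X)) ?index_mem ?s_enum //.
by rewrite nth_index ?s_enum.
Qed.

HB.instance Definition _ := PCanIsCountable enumerated_pcancel.

Fact enumerated_finite : Finite.axiom (undup s : seq Y).
Proof. by move=> x; rewrite count_uniq_mem ?undup_uniq // mem_undup s_enum. Qed.

HB.instance Definition _ := isFinite.Build Y enumerated_finite.

End Enumerated.

Lemma finite_zmod (X : zmodType) : finite_set [set: X] ->
  exists Y : finZmodType, isomorphic X Y.
Proof.
move=> /finite_seqP[s sX]; have s_enum x : x \in s.
  by have : [set: X] x by []; rewrite sX.
exists (enumerated s_enum : finZmodType); exact: isomorphic_refl.
Qed.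

(** By Cauchy's theorem a prime dividing the cardinal is the order of an
    element. *)
Lemma pgroup_of_orders (Y : finZmodType) (p : nat) :
  (forall q (y : Y), prime q -> q != p -> y *+ q = 0 -> y = 0) ->
  (p.-group [set: Y]%SET)%g.
Proof.
move=> ord; apply/pgroupP => q qp /Cauchy[//|y _ yq]; apply: contraT => qnp.
have y0 : y = 0.
  by apply: (ord q) => //; rewrite -FinRing.zmodXgE -yq expg_order.
by move: qp; rewrite -yq y0 -FinRing.zmod1gE order1.
Qed.

(** * Sorting cyclic factors, and the equivalence *)

(** Project to the factor and send its generator to [x]. *)
Lemma cyclic_factor_hom (A X : zmodType) n (q : 'I_n -> nat) (k : 'I_n) (x : X) :
  isomorphic A (dprodType (fun k => cyc (q k))) -> x != 0 -> x *+ q k = 0 ->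
  exists f : homType A X, f != 0.
Proof.
case=> f [g fK gK] x0 /cyc_hom[h hx].
have projB : zmod_morphism (fun z : dprodType (fun k => cyc (q k)) => z k) by [].
exists (h \o (additive_of projB \o f) : {additive A -> X}).
apply: contra_neq x0 => F0.
have := congr1 (fun F : homType A X =>
  F (g (single (A := fun k => cyc (q k)) (cgen (q k))))) F0.
by rewrite /= gK single_same hx.
Qed.

(** The multiple of the generator by [p ^ e]. *)
Lemma cyclic_factor_order (A : zmodType) n (q : 'I_n -> nat) (k : 'I_n) p e :
  isomorphic A (dprodType (fun k => cyc (q k))) -> prime p ->
  q k = (p ^ e.+1)%N -> exists a : A, a != 0 /\ a *+ p = 0.
Proof.
case=> f [g fK gK] pp qE.
pose c := single (A := fun k => cyc (q k)) (cgen (q k)).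
exists (g (c *+ (p ^ e))); split.
  apply/eqP => /(congr1 f); rewrite gK raddf0.
  move/(congr1 (fun z : dprodType (fun k => cyc (q k)) => z k)).
  rewrite dprod_mulrn /c single_same pmulrn => /cgen_eq0.
  by rewrite dvdzE !absz_nat qE dvdn_Pexp2l ?prime_gt1 // ltnn.
apply: (can_inj fK); rewrite raddfMn gK raddf0 -mulrnA mulnC -expnS -qE.
by rewrite /c -raddfMn cyc_mulrn raddf0.
Qed.

Section Structure.
Variables (I : Type) (A : I -> zmodType).
Hypothesis A_neq0 : forall i, exists x : A i, x != 0.
Hypothesis A_fg : forall i, finitely_generated (A i).

Lemma free_product : (forall i, free_group (A i)) ->
  exists K : Type, isomorphic (dprodType A) (K -> int).
Proof.
move=> freeA; have /choice[n isoA] i : exists n,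
    isomorphic (A i) (dprodType (fun _ : 'I_n => int : zmodType)).
  by apply: (fg_torsion_free (A_fg i)) => a; apply: free_torsion_free.
exists {i & 'I_(n i)}; apply: isomorphic_trans (isomorphic_dprod isoA) _.
apply: isomorphic_trans (isomorphic_dprod_sigma _) _.
by apply: (@isomorphic_of _ _ id) => // y; exists y.
Qed.

(** Split each [A i] into cyclic factors of infinite or prime power order and
    sort all the factors by that prime.  Two factors with the same label give a
    nonzero homomorphism between the groups they come from, so every label
    occurs finitely often. *)
Lemma finite_hom_product :
  (forall i, finite_set [set j | exists f : homType (A j) (A i), f != 0]) ->
  exists (F : zmodType) (Mp : primes_type -> finZmodType),
    [/\ finitely_generated F, free_group F,
        forall p : primes_type, ((sval p).-group [set: Mp p]%SET)%g &
        isomorphic (dprodType A)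
          (F * dprodType (fun p => Mp p : zmodType))%type].
Proof.
move=> finhom.
have /choice[n /(_ _)/cid-/all_sig[q qP]] := fun i => fg_cyclic (A_fg i).
pose L := {i & 'I_(n i)}.
pose Q (l : L) := q (projT1 l) (projT2 l).
have isoA i : isomorphic (A i) (dprodType (fun k => cyc (q i k))).
  by have [] := qP i.
have /choice[lab labP] (l : L) : exists o : option primes_type,
    if o is Some p then exists e, Q l = (sval p ^ e.+1)%N else Q l = 0%N.
  have [primq _] := qP (projT1 l); case: (primq (projT2 l)) => [q0|].
    by exists None.
  by case=> p [e [pp qE]]; exists (Some (exist _ p pp)), e.
have fin_lab o : finite_set [set l | lab l = o].
  have [[l0 l0o]|nol] := pselect (exists l, lab l = o); last first.
    by apply: (sub_finite_set _ (finite_set0 L)) => l lo; case: nol; exists l.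
  have hom_l l : lab l = o ->
      exists f : homType (A (projT1 l)) (A (projT1 l0)), f != 0.
    move=> lo; have := labP l; have := labP l0; rewrite l0o lo.
    case: o {l0o lo} => [p [e0 Q0] [e Ql]|_ Ql].
      have [x [x0 xp]] := cyclic_factor_order (isoA _) (svalP p) Q0.
      apply: (cyclic_factor_hom (isoA _) x0 (k := projT2 l)).
      by rewrite -/(Q l) Ql expnS mulrnA xp mul0rn.
    have [x x0] := A_neq0 (projT1 l0).
    apply: (cyclic_factor_hom (isoA _) x0 (k := projT2 l)).
    by rewrite -/(Q l) Ql.
  apply: (@sub_finite_set _ _ (\bigcup_(i in [set j |
      exists f : homType (A j) (A (projT1 l0)), f != 0])
      [set existT _ i k | k in [set: 'I_(n i)]])).
    by move=> [i k] /hom_l hi; exists i => //; exists k.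
  apply: bigcup_finite => // i _; apply: finite_image; exact: finite_finset.
have fin_fibre o : finite_set [set: {l | lab l = o}].
  have -> : [set: {l | lab l = o}] = sval @^-1` [set l | lab l = o].
    by apply/seteqP; split=> // -[].
  apply: finite_preimage (fin_lab o) => -[l e] [l' e'] _ _ /=.
  exact: eq_exist.
pose X p : zmodType := dprodType (fun l : {l | lab l = Some p} => cyc (Q (sval l))).
have /choice[Mp isoM] p : exists Y : finZmodType, isomorphic (X p) Y.
  apply: finite_zmod.
  have := @finite_dprod _ (fun l : {l | lab l = Some p} => cyc (Q (sval l)))
    setT (fun=> setT) (fin_fibre _) (fun=> Logic.I).
  move=> fin; apply: sub_finite_set (fin _) => [x _|[l ll]].
    by split=> // l; case.
  have := labP l; rewrite ll => -[e] /= ->.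
  have : (0 < sval p ^ e.+1)%N by rewrite expn_gt0 prime_gt0 //; exact: (svalP p).
  by case: (_ ^ _)%N => // m _; exact: finite_finset.
pose N := {l | lab l = None}.
exists (dsumType (fun _ : N => int : zmodType)), Mp; split.
- by apply: fg_dsum (fin_fibre None) _ => _; apply: fg_int.
- by exists N; apply: isomorphic_refl.
- move=> p; apply: pgroup_of_orders => r y rp rnp yr.
  have [f [g fK gK]] := isoM p; rewrite -[y]gK; suff -> : g y = 0 by apply: raddf0.
  have gyr : g y *+ r = 0.
    by apply: (can_inj fK); rewrite raddfMn gK yr raddf0.
  apply: functional_extensionality_dep => -[l ll].
  have := labP l; rewrite ll => -[e Ql].
  apply: (coprime_kill (m := r) (n := Q l)).
  + rewrite Ql coprimeXr // prime_coprime // dvdn_prime2 //; exact: (svalP p).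
  + by rewrite -(dprod_mulrn (g y)) gyr.
  + exact: cyc_mulrn.
apply: isomorphic_trans (isomorphic_dprod isoA) _.
apply: isomorphic_trans (isomorphic_dprod_sigma _) _.
apply: isomorphic_trans (isomorphic_dprod_label _ lab) _.
apply: isomorphic_prod; last exact: isomorphic_dprod.
apply: isomorphic_trans (isomorphic_dprod_dsum _ (fin_fibre _)).
apply: isomorphic_dprod => -[l ll] /=.
have := labP l; rewrite ll /Q => ->; exact: isomorphic_refl.
Qed.

End Structure.
Theorem theorem3p10 (I : Type) (A : I -> zmodType)
    (A_neq0 : forall i, exists x : A i, x != 0)
    (A_fg : forall i, finitely_generated (A i)) :
  let M : zmodType := dprodType A in
  let S : zmodType := dsumType A in
  [<-> self_small M;
       (forall x : S, x \in torsion S -> x = 0) \/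
       ((forall p : nat, prime p -> finite_set (pcomponent S p)) /\
        finitely_generated (Quotient.quot (torsion S)));
       (forall i, free_group (A i)) \/
       (forall i, finite_set [set j | exists f : homType (A j) (A i), f != 0]);
       (exists K : Type, isomorphic M (K -> int)) \/
       (exists (F : zmodType) (Mp : primes_type -> finZmodType),
          [/\ finitely_generated F, free_group F,
              forall p : primes_type, ((sval p).-group [set: Mp p]%SET)%g &
              isomorphic M (F * dprodType (fun p => Mp p : zmodType))%type])].
Proof.
move=> M S; split; first exact: self_small_torsion.
split; first exact: torsion_free_or_finite_hom.
split.
  by case=> [/(free_product A_fg)|/(finite_hom_product A_neq0 A_fg)]; [left|right].
case=> [[K iso]|[F [Mp [fgF freeF Mpp iso]]]]; apply: self_small_isomorphic iso _.
  exact: self_small_integer_power.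
exact: self_small_mixed.
Qed.
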